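(* Let $D$ and $H$ be acyclic digraphs. Then $D$ and $H$ are Bott equivalent if and only if the small covers over cubes $M(A_D)$ and $M(A_H)$ are diffeomorphic.
   Context: Digraphs. A digraph $D=(V,E)$ consists of a finite vertex set $V$ and a set $E$ of ordered pairs $(u,v)$ of distinct vertices (arcs). $D$ is acyclic if its vertices can be ordered $v_1,\dots,v_n$ so that $i<j$ for each arc $(v_i,v_j)$. Let $N_D^+(v)=\{w:(v,w)\in E\}$ (out-neighbors) and $N_D^-(v)=\{u:(u,v)\in E\}$ (in-neighbors). With respect to a fixed ordering $v_1,\dots,v_n$ of $V$, the adjacency matrix $A_D=(a_{ij})$ is the $n\times n$ matrix with $a_{ij}=1$ if $(v_i,v_j)\in E$ and $a_{ij}=0$ otherwise, regarded over $\mathbb{Z}_2$. Bott equivalence. Local complementation at a vertex $v$: $D*v$ is the digraph obtained from $D$ by toggling (adding if absent, removing if present) the arc $(u,w)$ for each pair $(u,w)\in N_D^-(v)\times N_D^+(v)$ with $u\ne w$. Slide: for two distinct vertices $v,w$ with $N_D^-(v)=N_D^-(w)$, $D\Delta vw$ is the digraph obtained from $D$ by replacing $N_D^+(w)$ by the symmetric difference $N_D^+(w)\Delta N_D^+(v)$. These operations preserve acyclicity. An acyclic digraph $H$ is Bott equivalent to an acyclic digraph $D$ if $H$ is isomorphic to a digraph obtained from $D$ by successively applying (finitely many) local complementations and slides. The small cover $M(A_D)$. Let $D$ be an acyclic digraph with $n$ vertices, with adjacency matrix $A=A_D$ with respect to a fixed ordering of the vertices (a different ordering gives a diffeomorphic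 manifold). Let $P=[0,1]^n$ be the cube with facets $F_j=\{x_j=0\}$ and $F_{n+j}=\{x_j=1\}$ for $1\le j\le n$. Define the characteristic function $\lambda:\{F_1,\dots,F_{2n}\}\to\mathbb{Z}_2^n$ by letting $\lambda(F_1),\dots,\lambda(F_{2n})$ be the columns of the $n\times 2n$ matrix $(I_n\mid I_n+A^t)$ over $\mathbb{Z}_2$; thus $\lambda(F_j)=e_j$ and $\lambda(F_{n+j})=e_j+\sum_i A_{ji}e_i$. Whenever $n$ facets of $P$ meet in a vertex, their images under $\lambda$ form a basis of $\mathbb{Z}_2^n$. For $p\in P$ let $G_p\subseteq\mathbb{Z}_2^n$ be the subgroup generated by all $\lambda(F)$ with $F$ a facet containing $p$. Then $$M(A)=P\times\mathbb{Z}_2^n/\sim,\qquad (p,g)\sim(q,h)\iff p=q \text{ and } g-h\in G_p .$$ This is a closed $n$-manifold (a small cover over the cube) with its standard smooth structure, given by the following charts, one for each vertex $v$ of $P$: let $F_{(1)},\dots,F_{(n)}$ be the facets containing $v$, where $F_{(l)}\in\{F_l,F_{n+l}\}$, let $U_v\subseteq P$ be the set of points lying on no facet other than these, and let $y_l(p)=|x_l(p)-x_l(v)|$. The chart sends the class of $(p,g)$, $p\in U_v$, $g=\sum_l g_l\lambda(F_{(l)})$, to $((-1)^{g_1}y_1(p),\dots,(-1)^{g_n}y_n(p))\in(-1,1)^n$. *)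

(* Defs.v *)
From HB Require Import structures.
From mathcomp Require Import all_boot all_order all_algebra all_fingroup.
From mathcomp Require Import all_classical all_reals topology normedtype derive.

Set Implicit Arguments.
Unset Strict Implicit.
Unset Printing Implicit Defensive.

Import Order.TTheory GRing.Theory Num.Theory.
Import numFieldNormedType.Exports.

Local Open Scope ring_scope.

(** * Digraphs and Bott equivalence *)

Record digraph (V : finType) := Digraph {
  arcs : {set V * V};
  arcs_neq : forall u v, (u, v) \in arcs -> u != v }.

Section Digraphs.
Variable V : finType.
Implicit Types (D : digraph V) (u v w : V).

Definition out_nbrs D v : {set V} := [set w | (v, w) \in arcs D]%SET.
Definition in_nbrs D v : {set V} := [set u | (u, v) \in arcs D]%SET.

Definition acyclic D : Prop :=
  exists2 s : 'I_#|V| -> V, bijective s &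
    forall i j, (s i, s j) \in arcs D -> (i < j)%N.

Definition local_complement_arcs D v : {set V * V} :=
  [set e | (e \in arcs D) (+)
     [&& e.1 \in in_nbrs D v, e.2 \in out_nbrs D v & e.1 != e.2]]%SET.

Lemma local_complement_neq D v a b :
  (a, b) \in local_complement_arcs D v -> a != b.
Proof.
rewrite inE /=; case: (boolP ((a, b) \in arcs D)) => [/arcs_neq //|_] /=.
by case/and3P.
Qed.

Definition local_complement D v : digraph V :=
  Digraph (@local_complement_neq D v).

Definition slide_arcs D v w : {set V * V} :=
  [set e | if e.1 == w
           then (e.2 \in out_nbrs D w) (+) (e.2 \in out_nbrs D v)
           else e \in arcs D]%SET.

Lemma slide_neq D v w : in_nbrs D v = in_nbrs D w ->
  forall a b, (a, b) \in slide_arcs D v w -> a != b.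
Proof.
move=> eqN a b; rewrite inE /=; case: (eqVneq a w) => [->|_]; last first.
  exact: arcs_neq.
apply: contraTneq => <-; rewrite !inE.
have /negPf-> : (w, w) \notin arcs D.
  by apply/negP => /arcs_neq; rewrite eqxx.
apply/negP => /= vw; have : v \in in_nbrs D w by rewrite inE.
by rewrite -eqN inE => /arcs_neq; rewrite eqxx.
Qed.

Definition slide D v w (eqN : in_nbrs D v = in_nbrs D w) : digraph V :=
  Digraph (slide_neq eqN).

Inductive bott_reachable D : digraph V -> Prop :=
| Bott_refl : bott_reachable D D
| Bott_local_complement D' v :
    bott_reachable D D' -> bott_reachable D (local_complement D' v)
| Bott_slide D' v w (eqN : in_nbrs D' v = in_nbrs D' w) :
    v != w -> bott_reachable D D' -> bott_reachable D (slide eqN).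

Definition adjacency_matrix n (s : 'I_n -> V) D : 'M['F_2]_n :=
  \matrix_(i, j) ((s i, s j) \in arcs D)%:R.

End Digraphs.

Definition digraph_iso (V W : finType) (D : digraph V) (H : digraph W) : Prop :=
  exists2 phi : V -> W, bijective phi &
    forall u v, ((phi u, phi v) \in arcs H) = ((u, v) \in arcs D).

Definition bott_equivalent (V W : finType) (H : digraph W) (D : digraph V) :
    Prop :=
  exists2 D' : digraph V, bott_reachable D D' & digraph_iso H D'.

(** * Small covers over cubes *)

Local Open Scope classical_set_scope.
Local Open Scope quotient_scope.

Definition cube (R : realType) n : set 'rV[R]_n :=
  [set x | forall i, 0 <= x 0 i <= 1].
Arguments cube : clear implicits.

(* The facet F_j is indexed by [lshift n j] and F_(n+j) by [rshift n j]. *)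
Definition on_facet (R : realType) n (p : 'rV[R]_n) (F : 'I_(n + n)) : bool :=
  match fintype.split F with
  | inl j => p 0 j == 0
  | inr j => p 0 j == 1
  end.

Section SmallCover.
Variables (R : realType) (n : nat) (A : 'M['F_2]_n).

Definition char_fun (F : 'I_(n + n)) : 'cV['F_2]_n :=
  col F (row_mx 1%:M (1%:M + A^T)).

Definition facet_group (p : 'rV[R]_n) : {group 'cV['F_2]_n} :=
  <<[set char_fun F | F in on_facet p]%SET>>%G.

Definition precover : topologicalType :=
  (cube R n * discrete_topology 'cV['F_2]_n)%type.

Definition cover_rel (a b : precover) : bool :=
  (a.1 == b.1) && ((a.2 : 'cV['F_2]_n) - b.2 \in facet_group (set_val a.1)).

Lemma cover_rel_refl : reflexive cover_rel.
Proof.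
by move=> a; rewrite /cover_rel eqxx subrr (group1 (facet_group _)).
Qed.

Lemma cover_rel_sym : symmetric cover_rel.
Proof.
suff gl a b : cover_rel a b -> cover_rel b a.
  by move=> a b; apply/idP/idP => /gl.
case/andP=> /eqP ab1 ab2; rewrite /cover_rel -ab1 eqxx /=.
by rewrite -opprB; exact: (@groupVr _ (facet_group _) _ ab2).
Qed.

Lemma cover_rel_trans : transitive cover_rel.
Proof.
move=> b a c /andP[/eqP ab1 ab2] /andP[/eqP bc1 bc2].
rewrite /cover_rel ab1 bc1 eqxx /= -bc1.
rewrite ab1 in ab2.
rewrite -(subrK (b.2 : 'cV['F_2]_n) a.2) -addrA.
exact: (@groupM _ (facet_group _) _ _ ab2 bc2).
Qed.

Canonical cover_equiv :=
  EquivRel cover_rel cover_rel_refl cover_rel_sym cover_rel_trans.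

Definition small_cover : topologicalType :=
  quotient_topology {eq_quot cover_equiv}.

Definition cover_class (a : precover) : small_cover :=
  \pi_(quotient_topology {eq_quot cover_equiv}) a.

Definition cover_repr (x : small_cover) : precover :=
  generic_quotient.repr (x : quotient_topology {eq_quot cover_equiv}).

(* A vertex of the cube is given by its 0/1 coordinates. *)
Definition vertex_facet (v : {ffun 'I_n -> bool}) (l : 'I_n) : 'I_(n + n) :=
  if v l then rshift n l else lshift n l.

Definition vertex_nbhd (v : {ffun 'I_n -> bool}) : set (cube R n) :=
  [set p | forall F, on_facet (set_val p) F -> exists l, F = vertex_facet v l].

Definition chart_dom (v : {ffun 'I_n -> bool}) : set small_cover :=
  cover_class @` [set a | vertex_nbhd v a.1].

(* [coord] yields the coordinates g_l of g in the vectors lambda(F_(l)); on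
   [chart_dom v] the value does not depend on the chosen representative, as
   g_l only varies when the point lies on F_(l). *)
Definition chart (v : {ffun 'I_n -> bool}) (x : small_cover) : 'rV[R]_n :=
  let: (p, g) := cover_repr x in
  \row_l ((-1) ^+ coord [tuple char_fun (vertex_facet v l) | l < n] l
                        (g : 'cV['F_2]_n)
           * `|set_val p 0 l - (v l)%:R|).

Lemma cube_0 : (0 : 'rV[R]_n) \in cube R n.
Proof. by apply/mem_set => i; rewrite mxE lexx ler01. Qed.

(* The default value is only taken outside the image of the chart. *)
Definition chart_inv (v : {ffun 'I_n -> bool}) : 'rV[R]_n -> small_cover :=
  'pinv_(fun=> cover_class (exist _ 0 cube_0, 0)) (chart_dom v) (chart v).

End SmallCover.
Arguments small_cover : clear implicits.
Arguments chart {R n} A v x.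
Arguments chart_dom {R n} A v.
Arguments chart_inv {R n} A v z.

(** * Smooth maps and diffeomorphisms *)

(* Meaningful for open U only: 'D_(e_i) f x depends on f near x. *)
Fixpoint Ck_on (R : realType) n m (k : nat) (U : set 'rV[R]_n)
    (f : 'rV[R]_n -> 'rV[R]_m) : Prop :=
  (forall x, U x -> {for x, continuous f}) /\
  if k is k'.+1 then
    forall i : 'I_n, (forall x, U x -> derivable f x (delta_mx 0 i)) /\
      Ck_on k' U (fun x => 'D_(delta_mx 0 i) f x)
  else True.

Definition smooth_on (R : realType) n m (U : set 'rV[R]_n)
    (f : 'rV[R]_n -> 'rV[R]_m) : Prop := forall k, Ck_on k U f.

Definition smooth_map (R : realType) n m (A : 'M['F_2]_n) (B : 'M['F_2]_m)
    (f : small_cover R n A -> small_cover R m B) : Prop :=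
  continuous f /\
  forall (v : {ffun 'I_n -> bool}) (w : {ffun 'I_m -> bool}),
    smooth_on (chart A v @` (chart_dom A v `&` f @^-1` chart_dom B w))
              (chart B w \o f \o chart_inv A v).

Definition diffeomorphic (R : realType) n m
    (A : 'M['F_2]_n) (B : 'M['F_2]_m) : Prop :=
  exists (f : small_cover R n A -> small_cover R m B)
         (g : small_cover R m B -> small_cover R n A),
    [/\ cancel f g, cancel g f, smooth_map f & smooth_map g].
Arguments diffeomorphic : clear implicits.

(* Main.v *)
Require Import Defs.
From HB Require Import structures.
From mathcomp Require Import all_boot all_order all_algebra all_fingroup.
From mathcomp Require Import all_classical all_reals topology normedtype derive.
From mathcomp Require Import ring lra zify.

(* The universal cover of M(A) is R^n, unfolding the cube by the reflections in
   its facets; its deck group is Z^n, with k acting by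
   x_j |-> 2 k_j + (-1)^((kA)_j) x_j.

   Relabellings, slides and local complementations are induced by affine maps of
   R^n that normalise the deck groups (a coordinate permutation, a shear, a unit
   translation), and maps with an affine lift are locally affine in the charts.

   Conversely a homeomorphism lifts to the universal covers and induces an
   isomorphism of deck groups, hence an invertible matrix P mod 2 between their
   abelianisations. A bilinear form M on the abelianisation of the deck group is
   the coboundary of some function only if M_ij + M_ji = A_ij M_jj + A_ji M_ii
   for i <> j; that the forms (x_j + alpha_j) (x) x_j, with alpha_j the j-th
   column, pull back along P to coboundaries replaces the isomorphism of the
   mod 2 cohomology rings. Such a P permutes the columns up to a matrix
   C + A diag(e), where C only mixes indices with equal columns: C is undone by
   slides (Gaussian elimination) and diag(e) by local complementations. *)

Set Implicit Arguments.
Unset Strict Implicit.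
Unset Printing Implicit Defensive.

Import Order.TTheory GRing.Theory Num.Theory.
Import numFieldNormedType.Exports.

Local Open Scope ring_scope.

(** The obstacle in the converse is that P is known only through quadratic identities. Read column j
    of P as the linear form u = sum_i P_ij x_i over F_2 and column j of PB as a form w. The
    identities say that u (u + w) is a combination of the polynomials x_i (x_i + alpha_i). The
    coefficients of the squares show that the indices i involved are those common to the supports of
    both factors. The mixed coefficients, in the absence of 2-cycles, give alpha_i = w for each such
    i and make the two supports nested. So u, possibly after adding w, is supported on a single
    class of equal columns of A, and the invertibility of P turns this into a permutation.

    The lifting argument rests on two features of the deck group: it preserves distances coordinate
    by coordinate, and distinct points of a fibre differ by at least 2 in some coordinate. This
    allows steps of one fixed size everywhere, with lifts compared instead of glued. *)

Lemma F2_cases (a : 'F_2) : {a = 0} + {a = 1}.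
Proof.
by case: a => [[|[|k]] //] lt; [left|right]; apply/val_inj.
Qed.

Lemma F2_addrr (a : 'F_2) : a + a = 0.
Proof. by case: (F2_cases a) => ->; apply/val_inj. Qed.

Lemma F2_eq1 (a : 'F_2) : a != 0 -> a = 1.
Proof. by case: (F2_cases a) => -> //; rewrite eqxx. Qed.

Lemma F2_addr_eq0 (a b : 'F_2) : a + b = 0 -> a = b.
Proof.
by move=> ab; rewrite -[LHS]addr0 -(F2_addrr b) addrA ab add0r.
Qed.

Ltac F2_case t := let E := fresh "E" in case: (F2_cases t) => E; rewrite ?E.

Ltac F2_decide := 
  repeat match goal with
  | |- (_ = _) -> _ => let H := fresh in move/eqP => H; vm_compute in H
  end; try (by []); try (by apply/eqP; vm_compute).

(** * Ranked matrices *)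

Definition equal_columns n (A : 'M['F_2]_n) i j := forall k, A k i = A k j.

(** The second clause lets one [r] serve along a whole chain of operations: a slide adds the row of
    [v] to that of [w], and the new arcs out of [w] still increase [r] because [r v = r w]. *)
Definition ranked n (r : 'I_n -> nat) (A : 'M['F_2]_n) :=
  (forall i j, A i j != 0 -> (r i < r j)%N) /\
  (forall i j, equal_columns A i j -> r i = r j).

Lemma ranked_diag n r (A : 'M['F_2]_n) i : ranked r A -> A i i = 0.
Proof. by case=> /(_ i i) rA _; apply: contraTeq isT => /rA; rewrite ltnn. Qed.

Lemma ranked_2cycle n r (A : 'M['F_2]_n) i j : ranked r A -> A i j * A j i = 0.
Proof.
case=> rA _; apply: contraTeq isT; rewrite mulf_eq0 negb_or => /andP[/rA ij /rA].
by rewrite ltnNge ltnW.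
Qed.

(** * Square-zero relations in degree two *)

(** For zero diagonal and alpha_j = sum_i A_ij x_i, this compares the coefficients of x_i x_j in
    sum_ij M_ij x_i x_j = sum_j M_jj x_j (x_j + alpha_j). *)
Definition quadratic_relation n (A M : 'M['F_2]_n) := forall i j, i != j ->
  M i j + M j i = A i j * M j j + A j i * M i i.

Section Relations.
Variables (n : nat) (r : 'I_n -> nat) (A : 'M['F_2]_n).
Hypothesis rA : ranked r A.

Section Product.
Variables (u w : 'I_n -> 'F_2).
Hypothesis relA : quadratic_relation A (\matrix_(i, j) (u i * w j)).

Let rel i j : i != j ->
  u i * w j + u j * w i = A i j * (u j * w j) + A j i * (u i * w i).
Proof. by move=> /relA; rewrite !mxE. Qed.

(** The relation at [k] and [i] carries the extra term [A i k * (u k * w k)]. It matters only if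
    A_ik = 1, and then A_ki = 0; the relation becomes u_k + w_k = u_k w_k, which over F_2 forces
    both to vanish. *)
Lemma relation_column i k : u i * w i != 0 -> A k i = u k + w k.
Proof.
move=> ui; have [ui1 wi1] : u i = 1 /\ w i = 1.
  by move: ui; F2_case (u i); F2_case (w i).
have [->|ki] := eqVneq k i; first by rewrite (ranked_diag _ rA) ui1 wi1 F2_addrr.
have := rel ki; have := ranked_2cycle i k rA; rewrite ui1 wi1 !mulr1 mul1r.
by F2_case (u k); F2_case (w k); F2_case (A k i); F2_case (A i k); F2_decide.
Qed.

(** If [p] lay only in the support of [u] and [q] only in that of [w], the coefficient of x_p x_q
    would be 1, while both square coefficients on the right vanish. *)
Lemma relation_support :
  (forall i, u i = u i * w i) \/ (forall i, w i = u i * w i).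
Proof.
case: (boolP [forall i, u i == u i * w i]) => [/forallP h|].
  by left=> i; apply/eqP.
rewrite negb_forall => /existsP[p up]; right=> q; apply/eqP; apply: contraT => wq.
have [up1 wp0] : u p = 1 /\ w p = 0 by move: up; F2_case (u p); F2_case (w p).
have [uq0 wq1] : u q = 0 /\ w q = 1 by move: wq; F2_case (u q); F2_case (w q).
have pq : p != q by apply: contraTneq isT => pq; move: up1; rewrite pq uq0.
by have := rel pq; rewrite up1 wp0 uq0 wq1 !(mulr0, mul0r, addr0).
Qed.

End Product.

Variables (rB : 'I_n -> nat) (B P : 'M['F_2]_n).
Hypotheses (rkB : ranked rB B) (Pu : P \in unitmx).
Hypothesis relP : forall j, quadratic_relation A
  (\matrix_(i, k) ((P i j + (P *m B) i j) * P k j)).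

(** Z_ij is the coefficient of x_i^2 in the relation of column j, so it records which generators x_i
    (x_i + alpha_i) occur there. *)
Let Z := \matrix_(i, j) ((P i j + (P *m B) i j) * P i j).

Let Z_column i j k : Z i j != 0 -> A k i = (P *m B) k j.
Proof.
rewrite mxE => /(relation_column (relP j)) -> /=.
by F2_case (P k j); F2_case ((P *m B) k j); F2_decide.
Qed.

(** The supports of the two factors are nested, so the smaller factor equals column j of Z; it is
    either P_j itself or P_j + (PB)_j. *)
Let Z_split j : {e : 'F_2 | forall i, P i j = Z i j + (P *m B) i j * e}.
Proof.
case: (boolP [forall i, P i j == Z i j]) => h.
  by exists 0 => i; rewrite mulr0 addr0; exact/eqP/(forallP h).
exists 1 => i; have [hs|hs] := relation_support (relP j); last first.
  by case/negP: h; apply/forallP => k; rewrite mxE -hs.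
rewrite mxE -hs mulr1; move: (P i j) ((P *m B) i j) => a b.
by rewrite -addrA F2_addrr addr0.
Qed.

(** A kernel vector of Z can be cut down to a class of equal columns of PB, because the nonzero
    entries in a row of Z all lie in one such class. On the class P differs from Z by multiples of
    the single column (PB)_j, so P sends the cut vector to 0 or to (PB)_j. The vector is then 0 or
    column j of B, and both have entry 0 at j. *)
Let Zu : Z \in unitmx.
Proof.
rewrite -unitmx_tr -row_free_unit -kermx_eq0; apply/rowV0P => t.
move/sub_kermxP/matrixP => Zt; apply/rowP => j; rewrite !mxE; apply: contraTeq isT => tj.
pose t' := \col_i (if [forall k, (P *m B) k i == (P *m B) k j] then t 0 i else 0).
have t'P i : t' i 0 != 0 -> forall k, (P *m B) k i = (P *m B) k j.
  by rewrite mxE; case: ifP => [/forallP h _ k|_]; [exact/eqP | rewrite eqxx].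
have Zt' : Z *m t' = 0.
  apply/colP => i; rewrite mxE [RHS]mxE.
  have Zt0 : \sum_l t 0 l * Z i l = 0.
    by have := Zt 0 i; rewrite mxE [RHS]mxE => Zt0; rewrite -[RHS]Zt0;
      apply: eq_bigr => l _; rewrite [Z^T _ _]mxE.
  case: (boolP [exists l, (Z i l != 0) && (t' l 0 != 0)]) => [/existsP[l /andP[Zl tl]]|].
    rewrite -[RHS]Zt0; apply: eq_bigr => l' _.
    F2_case (Z i l'); rewrite ?(mul0r, mulr0)// mulrC; congr (_ * _).
    rewrite mxE ifT//; apply/forallP => k; rewrite -(t'P _ tl).
    by rewrite -(Z_column k Zl) (@Z_column i l') // E.
  rewrite negb_exists => /forallP h; rewrite big1// => l _.
  by have := h l; rewrite negb_and !negbK => /orP[]/eqP->; rewrite ?(mul0r, mulr0).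
pose e i := projT1 (Z_split i).
have Pt' : P *m t' = \col_k ((\sum_i e i * t' i 0) * (P *m B) k j).
  apply/colP => k; rewrite [in RHS]mxE mxE.
  have -> : \sum_i P k i * t' i 0 = \sum_i Z k i * t' i 0 +
     \sum_i (e i * t' i 0) * (P *m B) k j.
    rewrite -big_split; apply: eq_bigr => i _ /=.
    rewrite (projT2 (Z_split i) k) -/(e i).
    have [->|/t'P ->] := eqVneq (t' i 0) 0; first by rewrite !(mulr0, mul0r, addr0).
    by ring.
  by have := Zt'; move/colP/(_ k); rewrite mxE [RHS]mxE => ->; rewrite add0r mulr_suml.
have t'j : t' j 0 = t 0 j by rewrite mxE ifT//; apply/forallP.
have := F2_cases (\sum_i e i * t' i 0); case=> se.
  have : t' = 0 by rewrite -[t'](mulKmx Pu) Pt' se; rewrite (_ : \col_k _ = 0) ?mulmx0//;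
    apply/colP => k; rewrite !mxE mul0r.
  by move/colP/(_ j); rewrite t'j mxE => /eqP; rewrite (negPf tj).
have {}Pt' : t' = col j B.
  apply: (can_inj (mulKmx Pu)); rewrite Pt' se colE mulmxA -colE.
  by apply/colP => k; rewrite !mxE mul1r.
have Bjj := ranked_diag j rkB.
have: t' j 0 = B j j by rewrite Pt' mxE.
by rewrite t'j Bjj => /eqP; rewrite (negPf tj).
Qed.

Lemma relation_normal_form : exists (sigma : 'S_n) (C : 'M['F_2]_n) (e : 'I_n -> 'F_2),
  [/\ C \in unitmx, forall i j, C i j != 0 -> equal_columns A i j,
      forall i j, P i (sigma j) = C i j + A i j * e j &
      forall i j, (P *m B) i (sigma j) = A i j].
Proof.
(* Some term of the Leibniz expansion of the nonzero determinant of Z is nonzero; its permutation is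
   the required one. *)
have [s Zs] : exists s : 'S_n, forall i, Z i (s i) != 0.
  suff /existsP[s /forallP Zs] : [exists s : 'S_n, forall i, Z i (s i) != 0].
    by exists s.
  move: Zu; rewrite unitmxE unitfE; apply: contraNT.
  rewrite negb_exists => /forallP h; rewrite /determinant big1// => s _.
  have := h s; rewrite negb_forall => /existsP[i]; rewrite negbK => /eqP Zi.
  by rewrite (bigD1 i)//= Zi mul0r mulr0.
have PBs i j : (P *m B) i (s j) = A i j by rewrite (Z_column i (Zs j)).
exists s, (col_perm s Z), (fun j => projT1 (Z_split (s j))); split.
- by rewrite col_permE unitmx_mul Zu unitmx_perm.
- by move=> i j; rewrite mxE => Zij k; rewrite (Z_column k Zij) PBs.
- by move=> i j; rewrite [col_perm _ _ _ _]mxE (projT2 (Z_split _) i) PBs.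
- exact: PBs.
Qed.

End Relations.

(** * Row operations realised by slides and local complementations *)

(** [A] selects the row operation and [P] undergoes it, so that the same operation can also be
    applied to a transition matrix. *)
Definition mx_local_complement n (v : 'I_n) (A P : 'M['F_2]_n) : 'M['F_2]_n :=
  \matrix_(i, j) (P i j + A i v * P v j).

Definition mx_slide n (v w : 'I_n) (P : 'M['F_2]_n) : 'M['F_2]_n :=
  \matrix_(i, j) (P i j + (i == w)%:R * P v j).

Inductive mx_reachable n (A : 'M['F_2]_n) : 'M['F_2]_n -> Prop :=
| Mx_refl : mx_reachable A A
| Mx_local_complement A' v : mx_reachable A A' ->
    mx_reachable A (mx_local_complement v A' A')
| Mx_slide A' v w : v != w -> equal_columns A' v w -> mx_reachable A A' ->
    mx_reachable A (mx_slide v w A').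

Lemma mx_reachable_trans n (A A1 A2 : 'M['F_2]_n) :
  mx_reachable A A1 -> mx_reachable A1 A2 -> mx_reachable A A2.
Proof.
move=> AA1; elim=> // [A' v _ IH|A' v w vw eqc _ IH].
  exact: Mx_local_complement.
exact: Mx_slide.
Qed.

Lemma mx_slideE n v w (P : 'M['F_2]_n) :
  mx_slide v w P = (1%:M + delta_mx w v) *m P.
Proof.
apply/matrixP => i j; rewrite mulmxDl mul1mx !mxE; congr (_ + _).
rewrite (bigD1 v)//= mxE eqxx andbT big1 ?addr0// => k kv.
by rewrite mxE (negPf kv) andbF mul0r.
Qed.

Lemma mx_local_complementE n v (A P : 'M['F_2]_n) :
  mx_local_complement v A P = (1%:M + A *m delta_mx v v) *m P.
Proof.
apply/matrixP => i j; rewrite mulmxDl mul1mx !mxE; congr (_ + _).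
rewrite (bigD1 v)//= big1 ?addr0 => [|k kv]; rewrite mxE (bigD1 v)//= mxE.
  by rewrite !eqxx big1 ?addr0 ?mulr1// => k kv; rewrite mxE (negPf kv) mulr0.
rewrite (negPf kv) andbF mulr0 add0r big1 ?mul0r// => l lv.
by rewrite mxE (negPf lv) mulr0.
Qed.

Section Ranked.
Variables (n : nat) (r : 'I_n -> nat).
Implicit Types A : 'M['F_2]_n.

Lemma mx_slideK v w A : v != w -> mx_slide v w (mx_slide v w A) = A.
Proof.
move=> vw; apply/matrixP => i j; rewrite !mxE (negPf vw) mul0r addr0.
by rewrite -addrA F2_addrr addr0.
Qed.

Lemma mx_local_complementK v A : A v v = 0 ->
  mx_local_complement v (mx_local_complement v A A) (mx_local_complement v A A) = A.
Proof.
move=> Av; apply/matrixP => i j; rewrite !mxE Av !(mulr0, mul0r, addr0).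
by rewrite -addrA F2_addrr addr0.
Qed.

Lemma equal_columns_slide v w A i j : equal_columns A i j ->
  equal_columns (mx_slide v w A) i j.
Proof. by move=> h k; rewrite !mxE !h. Qed.

Lemma equal_columns_local_complement v A i j : equal_columns A i j ->
  equal_columns (mx_local_complement v A A) i j.
Proof. by move=> h k; rewrite !mxE !h. Qed.

Lemma ranked_slide v w A : v != w -> equal_columns A v w -> ranked r A ->
  ranked r (mx_slide v w A).
Proof.
move=> vw eqc [rA rc]; split=> [i j|i j /(equal_columns_slide v w)]; last first.
  by rewrite mx_slideK// => /rc.
rewrite mxE; have [->|_] := eqVneq i w; last by rewrite mul0r addr0 => /rA.
rewrite mul1r; have [Aw|/rA //] := eqVneq (A w j) 0.
by rewrite Aw add0r => /rA; rewrite (rc _ _ eqc).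
Qed.

Lemma ranked_local_complement v A : ranked r A ->
  ranked r (mx_local_complement v A A).
Proof.
move=> rkA; have Av := ranked_diag v rkA; case: rkA => rA rc.
split=> [i j|i j /(equal_columns_local_complement v)]; last first.
  by rewrite mx_local_complementK// => /rc.
rewrite mxE; have [Aij|/rA //] := eqVneq (A i j) 0.
rewrite Aij add0r mulf_eq0 negb_or => /andP[/rA iv /rA]; exact: ltn_trans.
Qed.

(** Row operations multiply the equation from the left and leave [B] alone. The goal of the
    reduction is C = 1 and e = 0, where the equation reads B = A. *)
Definition reducible A B C (e : 'I_n -> 'F_2) :=
  [/\ ranked r A, C \in unitmx, forall i j, C i j != 0 -> equal_columns A i j &
      (\matrix_(i, j) (C i j + A i j * e j)) *m B = A].

Lemma reducible_slide v w A B C e : v != w -> equal_columns A v w ->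
  reducible A B C e -> reducible (mx_slide v w A) B (mx_slide v w C) e.
Proof.
move=> vw eqc [rA Cu CA PB]; split.
- exact: ranked_slide.
- have /(congr1 (fun M => \det M)) := mx_slideK 1%:M vw.
  rewrite [mx_slide v w (mx_slide _ _ _)]mx_slideE {1}mx_slideE mulmx1 det_mulmx det1 => d.
  rewrite mx_slideE unitmx_mul Cu andbT unitmxE unitfE.
  by apply: contraTneq isT => d0; move/eqP: d; rewrite d0 mul0r eq_sym oner_eq0.
- move=> i j Cij; apply: equal_columns_slide; move: Cij; rewrite mxE.
  have [->|_] := eqVneq i w; last by rewrite mul0r addr0; exact: CA.
  have [->|Cw _] := eqVneq (C w j) 0; last exact: CA.
  by rewrite add0r mul1r => Cvj k; rewrite -(CA _ _ Cvj) eqc.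
- rewrite -[in RHS]PB !mx_slideE mulmxA; congr (_ *m _).
  rewrite -!mx_slideE; apply/matrixP => i j; rewrite !mxE.
  by ring.
Qed.

(* Gaussian elimination of column j: adding the row j to the row i is a slide
   because both indices lie in the same class of equal columns. *)
Lemma clear_column (j : 'I_n) A B C e : reducible A B C e -> C j j = 1 ->
  (forall i k : 'I_n, (k < j)%N -> C i k = (i == k)%:R) ->
  exists A' C', [/\ mx_reachable A A', reducible A' B C' e &
    forall i k : 'I_n, (k <= j)%N -> C' i k = (i == k)%:R].
Proof.
move: {2}(#|_|) (leqnn #|[set i | (i != j) && (C i j != 0)]|) => m.
elim: m A C => [|m IH] A C.
  rewrite leqn0 cards_eq0 => /eqP h red Cj Ck; exists A, C; split=> //.
    exact: Mx_refl.
  move=> i k; rewrite leq_eqVlt => /orP[/eqP/val_inj->|]; last exact: Ck.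
  have [->|ij] := eqVneq i j; first exact: Cj.
  by move/setP/(_ i): h; rewrite !inE ij /= => /negbFE/eqP.
move=> le red Cj Ck.
have [i /= /andP[ij Cij]|no] := pickP (fun i => (i != j) && (C i j != 0)); last first.
  by apply: (IH A C) => //; rewrite eq_card0// => i; rewrite !inE no.
have ji : j != i by rewrite eq_sym.
have eqc : equal_columns A j i.
  by case: red => _ _ /(_ _ _ Cij) h _ k; rewrite h.
have [||||A' [C' [AA' red' C'k]]] := IH (mx_slide j i A) (mx_slide j i C).
- rewrite -ltnS; apply: leq_trans le; apply/proper_card/properP; split.
    apply/fintype.subsetP => k; rewrite !inE => /andP[->]; rewrite mxE.
    have [->|] := eqVneq k i; first by rewrite mul1r Cj (F2_eq1 Cij) F2_addrr eqxx.
    by rewrite mul0r addr0.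
  exists i; rewrite !inE ?ij// mxE eqxx mul1r Cj (F2_eq1 Cij) F2_addrr eqxx.
  by rewrite andbF.
- exact: reducible_slide.
- by rewrite mxE (negPf ji) mul0r addr0.
- move=> l k kj; rewrite mxE !Ck// [j == k]eq_sym.
  by rewrite (_ : (k == j) = false) ?mulr0 ?addr0//; apply/eqP => kE; rewrite kE ltnn in kj.
exists A', C'; split=> //; apply: mx_reachable_trans AA'.
by apply: Mx_slide => //; exact: Mx_refl.
Qed.

Lemma reduce_columns m A B C e : reducible A B C e -> (m <= n)%N ->
  exists A' C', [/\ mx_reachable A A', reducible A' B C' e &
    forall i k : 'I_n, (k < m)%N -> C' i k = (i == k)%:R].
Proof.
move=> red; elim: m => [_|m IH mn].
  by exists A, C; split=> //; exact: Mx_refl.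
have [A1 [C1 [AA1 red1 C1k]]] := IH (ltnW mn).
pose j := Ordinal mn.
have [A2 [C2 [A12 red2 C2j C2k]]] : exists A2 C2, [/\ mx_reachable A1 A2,
    reducible A2 B C2 e, C2 j j = 1 &
    forall i k : 'I_n, (k < j)%N -> C2 i k = (i == k)%:R].
  have [C1j|/F2_eq1 C1j] := eqVneq (C1 j j) 0; last first.
    by exists A1, C1; split=> //; exact: Mx_refl.
  have [i /= /andP[ji Cij]|no] := pickP (fun i : 'I_n => (j <= i)%N && (C1 i j != 0)).
    have nij : i != j by apply: contraNneq Cij => ->; rewrite C1j.
    have eqc : equal_columns A1 i j by case: red1 => _ _ /(_ _ _ Cij).
    exists (mx_slide i j A1), (mx_slide i j C1); split=> //.
    - by apply: Mx_slide => //; exact: Mx_refl.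
    - exact: reducible_slide.
    - by rewrite mxE eqxx C1j add0r mul1r (F2_eq1 Cij).
    - move=> l k kj; rewrite mxE !C1k// (_ : (i == k) = false) ?mulr0 ?addr0//.
      by apply/eqP => ik; move: ji; rewrite ik leqNgt kj.
  have [_ C1u _ _] := red1.
  (* Without a pivot, column j is supported in rows before j, hence is a combination of the
     preceding unit columns; [z] is the resulting kernel vector. *)
  pose z : 'cV['F_2]_n := \col_i (if i == j then 1 else C1 i j).
  have C1z : C1 *m z = 0.
    apply/colP => i; rewrite [LHS]mxE [RHS]mxE (bigD1 j)//= [z j 0]mxE eqxx mulr1.
    rewrite (eq_bigr (fun k => (i == k)%:R * C1 k j)) => [|k kj]; last first.
      rewrite [z k 0]mxE (negPf kj); have [kj'|kj'] := ltnP k j; first by rewrite (C1k i k kj').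
      by move: (no k); rewrite kj' /= => /negbFE/eqP->; rewrite !mulr0.
    have [->|ij] := eqVneq i j.
      by rewrite C1j add0r big1// => k kj; rewrite eq_sym (negPf kj) mul0r.
    rewrite (bigD1 i)//= eqxx mul1r big1 ?addr0 ?F2_addrr// => k /andP[_ ki].
    by rewrite eq_sym (negPf ki) mul0r.
  have /colP/(_ j) : z = 0 by rewrite -[z](mulKmx C1u) C1z mulmx0.
  by rewrite !mxE eqxx => /eqP; rewrite oner_eq0.
have [A3 [C3 [A23 red3 C3k]]] := clear_column red2 C2j C2k.
exists A3, C3; split=> //.
exact: mx_reachable_trans AA1 (mx_reachable_trans A12 A23).
Qed.

(** With A' the complemented matrix, (1 + A E_vv)(1 + A diag(e)) = 1 + A' diag(e) + A E_vv. As A_vv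
    = 0, the matrices A and A' share column v, so the last term cancels the contribution of e_v =
    1. *)
Lemma reducible_local_complement v A B e : reducible A B 1%:M e -> e v = 1 ->
  reducible (mx_local_complement v A A) B 1%:M (fun i => if i == v then 0 else e i).
Proof.
move=> [rA Cu CA PB] ev; have Av := ranked_diag v rA.
split=> // [|i j|]; first exact: ranked_local_complement.
  by rewrite mxE; case: (eqVneq i j) => [-> _ k|] //; rewrite eqxx.
rewrite [RHS]mx_local_complementE -[X in _ = _ *m X]PB mulmxA; congr (_ *m _).
rewrite -mx_local_complementE; apply/matrixP => i j; rewrite !mxE.
have [->|jv] := eqVneq j v.
  by rewrite ev Av mulr0 mul0r !addr0 !mulr1 -addrA F2_addrr addr0.
by rewrite add0r; ring.
Qed.

Lemma reducible_reachable A B C e : reducible A B C e -> mx_reachable A B.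
Proof.
move=> /reduce_columns/(_ (leqnn n))[A' [C' [AA' red C'1]]].
apply: mx_reachable_trans AA' _.
have {C'1} C'1 : C' = 1%:M by apply/matrixP => i j; rewrite C'1// mxE.
rewrite {}C'1 in red; move: {2}(#|_|) (leqnn #|[set i | e i != 0]|) => m.
elim: m A' e red => [|m IH] A' e red.
  rewrite leqn0 cards_eq0 => /eqP h; case: red => _ _ _ <-.
  rewrite (_ : \matrix_(i, j) _ = 1%:M) ?mul1mx; last first.
    apply/matrixP => i j; rewrite !mxE.
    by move/setP/(_ j): h; rewrite !inE => /negbFE/eqP->; rewrite mulr0 addr0.
  exact: Mx_refl.
move=> le; have [v ev|no] := pickP (fun i => e i != 0); last first.
  by apply: IH red _; rewrite eq_card0// => i; rewrite !inE no.
have := reducible_local_complement red (F2_eq1 ev) => /IH h.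
apply: mx_reachable_trans (h _).
  by apply: Mx_local_complement; exact: Mx_refl.
rewrite -ltnS; apply: leq_trans le; apply/proper_card/properP; split.
  by apply/fintype.subsetP => k; rewrite !inE; case: (k == v) => //; rewrite eqxx.
by exists v; rewrite !inE ?eqxx.
Qed.

End Ranked.

Lemma relations_reachable n r rB (A B P : 'M['F_2]_n) :
  ranked r A -> ranked rB B -> P \in unitmx ->
  (forall j, quadratic_relation A
    (\matrix_(i, k) ((P i j + (P *m B) i j) * P k j))) ->
  exists sigma : 'S_n, mx_reachable A (\matrix_(i, j) B (sigma i) (sigma j)).
Proof.
move=> rA rkB Pu relP.
have [s [C [e [Cu CA PE PBE]]]] := relation_normal_form rA rkB Pu relP.
exists s; apply: (@reducible_reachable n r _ _ C e); split=> //.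
apply/matrixP => i j; rewrite !mxE -PBE mxE [RHS](reindex_inj (@perm_inj _ s)).
by apply: eq_bigr => k _; rewrite !mxE PE.
Qed.

(** * From digraphs to matrices over F_2 *)

Section DigraphMatrix.
Variables (V : finType) (n : nat) (s : 'I_n -> V) (t : V -> 'I_n).
Hypotheses (sK : cancel s t) (tK : cancel t s).
Implicit Types D : digraph V.

Let sI : injective s := can_inj sK.

Local Notation adj D := (adjacency_matrix s D).

Lemma adjacencyE D i j : adj D i j = ((s i, s j) \in arcs D)%:R.
Proof. exact: mxE. Qed.

Lemma equal_columns_in_nbrs D i j :
  equal_columns (adj D) i j <-> in_nbrs D (s i) = in_nbrs D (s j).
Proof.
split=> [h|/setP h k]; last by have := h (s k); rewrite !adjacencyE !inE => ->.
apply/setP => u; have := h (t u); rewrite !adjacencyE !inE tK.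
by do 2![case: (_ \in _)].
Qed.

(* Ranking a vertex by its latest in-neighbour makes the rank depend on the
   in-neighbourhood only. *)
Lemma acyclic_ranked D : acyclic D -> exists r, ranked r (adj D).
Proof.
case=> o [o' oK o'K] oD.
pose rk (v : V) := (\max_(u in in_nbrs D v) (o' u).+1)%N.
have rk_le v : (rk v <= o' v)%N.
  apply/bigmax_leqP => u; rewrite inE => uv.
  by apply: oD; rewrite !o'K.
exists (fun i => rk (s i)); split=> i j; last first.
  by move=> /equal_columns_in_nbrs h; rewrite /rk h.
rewrite adjacencyE; have [ij _|//] := boolP (_ \in _).
apply: leq_ltn_trans (rk_le _) _.
by rewrite /rk (bigD1 (s i)) ?inE//= leq_maxl.
Qed.

(** The matrix formula agrees with the exclusion of loops in [local_complement]: on the diagonal it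
    adds a product A_ji A_ij, which is zero for lack of 2-cycles. *)
Lemma adjacency_local_complement r D i : ranked r (adj D) ->
  adj (local_complement D (s i)) = mx_local_complement i (adj D) (adj D).
Proof.
move=> rD; apply/matrixP => j k; rewrite [RHS]mxE !adjacencyE !inE /=.
have := ranked_2cycle j i rD; rewrite !adjacencyE.
have [->|jk] := eqVneq (s j) (s k).
  rewrite andbF andbF => h.
  by rewrite [in X in _ + _ * X]/= h addr0 addbF.
move=> _; rewrite andbT.
by do 3![case: (_ \in _)]; apply/val_inj.
Qed.

Lemma adjacency_slide D i j (eqN : in_nbrs D (s i) = in_nbrs D (s j)) :
  adj (slide eqN) = mx_slide i j (adj D).
Proof.
apply/matrixP => k l; rewrite [RHS]mxE !adjacencyE !inE /= (inj_eq sI).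
have [->|_] := eqVneq k j; last by rewrite mul0r addr0.
by do 2![case: (_ \in _)]; apply/val_inj.
Qed.

Lemma mx_reachable_bott D A : (exists r, ranked r (adj D)) ->
  mx_reachable (adj D) A ->
  exists2 D', bott_reachable D D' & adj D' = A.
Proof.
move=> [r rD] h.
suff [D' DD' [D'A _]] : exists2 D', bott_reachable D D' & adj D' = A /\ ranked r A.
  by exists D'.
elim: h => [|A' v _ [D' DD' [D'A' rA']]|A' v w vw eqc _ [D' DD' [D'A' rA']]].
- by exists D; [exact: Bott_refl | split].
- exists (local_complement D' (s v)); first exact: Bott_local_complement.
  split; last exact: ranked_local_complement.
  by rewrite -D'A' in rA' *; exact: adjacency_local_complement rA'.
- have eqN : in_nbrs D' (s v) = in_nbrs D' (s w).
    by apply/equal_columns_in_nbrs; rewrite D'A'.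
  exists (slide eqN); first by apply: Bott_slide => //; rewrite (inj_eq sI).
  by split; [rewrite adjacency_slide D'A' | exact: ranked_slide].
Qed.

Lemma bott_mx_reachable D D' r : ranked r (adj D) ->
  bott_reachable D D' -> mx_reachable (adj D) (adj D') /\ ranked r (adj D').
Proof.
move=> rD; elim=> [|{}D' v _ [DD' rD']|{}D' v w eqN vw _ [DD' rD']].
- by split=> //; exact: Mx_refl.
- rewrite -(tK v) (adjacency_local_complement _ rD').
  by split; [exact: Mx_local_complement | exact: ranked_local_complement].
- rewrite -(tK v) -(tK w) in eqN vw *; rewrite adjacency_slide.
  have eqc : equal_columns (adj D') (t v) (t w) by apply/equal_columns_in_nbrs.
  have tvw : t v != t w by rewrite (inj_eq sI) in vw.
  by split; [exact: Mx_slide | exact: ranked_slide].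
Qed.

End DigraphMatrix.

Lemma bott_equivalentE (V W : finType) (D : digraph V) (H : digraph W) n m
    (s : 'I_n -> V) (t : 'I_m -> W) :
  acyclic D -> bijective s -> bijective t ->
  bott_equivalent H D <-> exists2 A, mx_reachable (adjacency_matrix s D) A &
    exists2 f : 'I_m -> 'I_n, bijective f &
      forall i j, adjacency_matrix t H i j = A (f i) (f j).
Proof.
move=> aD [s' sK s'K] [t' tK t'K].
have [r rD] := acyclic_ranked s'K aD.
split=> [[D' DD' [f [f' fK f'K] fH]]|[A DA [f [f' fK f'K] fH]]].
  have [DD'A _] := bott_mx_reachable sK s'K rD DD'.
  exists (adjacency_matrix s D') => //; exists (fun i => s' (f (t i))).
    exists (fun i => t' (f' (s i))) => i; first by rewrite s'K fK tK.
    by rewrite t'K f'K sK.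
  by move=> i j; rewrite !adjacencyE !s'K fH.
have [D' DD' D'A] := mx_reachable_bott sK s'K (ex_intro _ r rD) DA.
exists D' => //; exists (fun w => s (f (t' w))).
  exists (fun v => t (f' (s' v))) => w; first by rewrite sK fK t'K.
  by rewrite tK f'K s'K.
move=> u v; have := fH (t' u) (t' v); rewrite -D'A !adjacencyE !t'K.
by do 2![case: (_ \in _)].
Qed.

(** * The deck group of a small cover over a cube *)

Definition sg {S : pzRingType} (a : 'F_2) : S := (-1) ^+ a.

Section Sign.
Variable S : pzRingType.
Implicit Types a b : 'F_2.

Lemma sg0 : sg 0 = 1 :> S. Proof. by []. Qed.

Lemma sg1 : sg 1 = -1 :> S. Proof. exact: expr1. Qed.

Lemma sgD a b : sg (a + b) = sg a * sg b :> S.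
Proof.
case: (F2_cases a) => ->; case: (F2_cases b) => ->;
  rewrite ?add0r ?addr0 ?F2_addrr ?sg0 ?sg1 ?mul1r ?mulr1 //.
by rewrite mulrNN mulr1.
Qed.

Lemma sg_sqr a : sg a * sg a = 1 :> S.
Proof. by rewrite -sgD F2_addrr. Qed.

Lemma intr_sg a : (sg a)%:~R = sg a :> S.
Proof. by case: (F2_cases a) => ->; rewrite ?sg0 ?sg1 // mulrN1z. Qed.

End Sign.

Lemma sg_F2 a : sg a = 1 :> 'F_2.
Proof. by case: (F2_cases a) => -> //; rewrite sg1; apply/val_inj. Qed.

Lemma norm_sgF2 (S : realDomainType) a : `|sg a| = 1 :> S.
Proof. by case: (F2_cases a) => ->; rewrite ?sg0 ?sg1 ?normrN normr1. Qed.

Definition parity n (k : 'rV[int]_n) : 'rV['F_2]_n := map_mx intr k.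

Definition twist n (A : 'M['F_2]_n) (k : 'rV[int]_n) : 'rV['F_2]_n :=
  parity k *m A.

Definition deck_mul n (A : 'M['F_2]_n) (k l : 'rV[int]_n) : 'rV[int]_n :=
  \row_j (k 0 j + sg (twist A k 0 j) * l 0 j).

Definition deck_inv n (A : 'M['F_2]_n) (k : 'rV[int]_n) : 'rV[int]_n :=
  \row_j - (sg (twist A k 0 j) * k 0 j).

Definition deck (R : realType) n (A : 'M['F_2]_n) (k : 'rV[int]_n) (x : 'rV[R]_n) : 'rV[R]_n :=
  \row_j (2 * (k 0 j)%:~R + sg (twist A k 0 j) * x 0 j).

Section Deck.
Variables (R : realType) (n : nat) (A : 'M['F_2]_n).
Implicit Types (k l : 'rV[int]_n) (x y : 'rV[R]_n).

Lemma deckE k x j :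
  deck A k x 0 j = 2 * (k 0 j)%:~R + sg (twist A k 0 j) * x 0 j.
Proof. exact: mxE. Qed.

Lemma deck_mulE k l j :
  deck_mul A k l 0 j = k 0 j + sg (twist A k 0 j) * l 0 j.
Proof. exact: mxE. Qed.

Lemma deck_invE k j : deck_inv A k 0 j = - (sg (twist A k 0 j) * k 0 j).
Proof. exact: mxE. Qed.

Lemma parity_deck_mul k l : parity (deck_mul A k l) = parity k + parity l.
Proof. by apply/rowP => j; rewrite !mxE intrD intrM intr_sg sg_F2 mul1r. Qed.

Lemma twist_deck_mul k l : twist A (deck_mul A k l) = twist A k + twist A l.
Proof. by rewrite /twist parity_deck_mul mulmxDl. Qed.

Lemma parity0 : parity 0 = 0 :> 'rV_n.
Proof. by apply/rowP => j; rewrite !mxE. Qed.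

Lemma twist0 : twist A 0 = 0.
Proof. by rewrite /twist parity0 mul0mx. Qed.

Lemma twist_deck_inv k : twist A (deck_inv A k) = twist A k.
Proof.
congr (_ *m _); apply/rowP => j; rewrite !mxE intrN intrM intr_sg sg_F2 mul1r.
by case: (F2_cases (k 0 j)%:~R) => ->; apply/val_inj.
Qed.

Lemma deckM k l x : deck A k (deck A l x) = deck A (deck_mul A k l) x.
Proof.
apply/rowP => j.
rewrite !deckE twist_deck_mul deck_mulE [fun_of_matrix (_ + _) _ _]mxE.
by rewrite sgD intrD intrM intr_sg; ring.
Qed.

Lemma deck0 x : deck A 0 x = x.
Proof. by apply/rowP => j; rewrite deckE twist0 !mxE sg0 mulr0 add0r mul1r. Qed.

Lemma deck_invK k : cancel (deck A k) (deck A (deck_inv A k) : 'rV[R]_n -> _).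
Proof.
move=> x; apply/rowP => j.
rewrite !deckE twist_deck_inv deck_invE intrN intrM intr_sg.
by have := sg_sqr R (twist A k 0 j) => s1; ring: s1.
Qed.

Lemma deck_dist k x y j :
  `|deck A k x 0 j - deck A k y 0 j| = `|x 0 j - y 0 j|.
Proof.
rewrite !deckE opprD addrACA subrr add0r -mulrBr normrM norm_sgF2 mul1r.
by [].
Qed.

(* A deck transformation acts by a pure translation on each coordinate of minimal
   rank among those j with k_j <> 0. *)
Lemma deck_free r k x : ranked r A -> (forall j, `|deck A k x 0 j - x 0 j| < 2) ->
  k = 0.
Proof.
move=> rA small; apply/rowP => j; rewrite [RHS]mxE.
have [m] := ubnP (r j); elim: m j => // m IH j jm.
have tj : twist A k 0 j = 0.
  rewrite mxE big1// => i _; rewrite mxE; have [->|Aij] := eqVneq (A i j) 0.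
    by rewrite mulr0.
  by rewrite IH ?mul0r//; exact: leq_trans (rA.1 _ _ Aij) jm.
move: (small j); rewrite deckE tj sg0 mul1r addrK normrM.
rewrite (@ger0_norm _ 2)// -[ltRHS]mulr1 ltr_pM2l// -intr_norm (_ : 1 = 1%:~R)//.
by rewrite ltr_int; case: (k 0 j) => [[|]|].
Qed.

Definition same_orbit x y := exists k, y = deck A k x.

Lemma same_orbit_refl x : same_orbit x x.
Proof. by exists 0; rewrite deck0. Qed.

Lemma same_orbit_sym x y : same_orbit x y -> same_orbit y x.
Proof. by case=> k ->; exists (deck_inv A k); rewrite deck_invK. Qed.

Lemma same_orbit_trans y x z : same_orbit x y -> same_orbit y z -> same_orbit x z.
Proof. by case=> k -> [l ->]; exists (deck_mul A l k); rewrite deckM. Qed.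

End Deck.

(** * The universal covering map *)

(** The copy [g] of the cube is placed in the orthant of [-1, 1]^n with signs (-1)^(g_j). The 2^n
    copies fill that cube, which meets every orbit. *)
Definition fan (R : realType) n (p : 'rV[R]_n) (g : 'cV['F_2]_n) : 'rV[R]_n :=
  \row_j (sg (g j 0) * p 0 j).

(** A translation by 2z keeps a point of [-1, 1] in that interval only if z = 0 or if it carries one
    endpoint to the other. The sign in front of p is determined only away from p = 0. *)
Lemma unit_interval_reflection (R : realType) (p q : R) (z : int) (a b : 'F_2) :
  0 <= p <= 1 -> 0 <= q <= 1 -> sg a * q = 2 * z%:~R + sg b * p ->
  (z = 0 \/ p = 1 /\ q = 1) /\ (p != 0 -> a = b + z%:~R).
Proof.
move=> /andP[p0 p1] /andP[q0 q1].
have sgE (S : pzRingType) (c : 'F_2) : sg c = (if c == 0 then 1 else -1) :> S.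
  by case: (F2_cases c) => ->.
rewrite !sgE => zE; have z1 : `|z| <= 1.
  rewrite -(ler_int R) intr_norm ler_norml.
  by move: zE; case: eqP; case: eqP => _ _ zE; apply/andP; split; lra.
have [z0|z1'|zN1] : [\/ z = 0, z = 1 | z = -1].
- by case: z z1 {zE} => [[|[|]]|[|]]//; [constructor 1|constructor 2|constructor 3].
- split; [by left | move: zE; rewrite z0 mulr0 add0r addr0].
  case: (F2_cases a) => ->; case: (F2_cases b) => -> //=; rewrite mul1r mulN1r => zE p0'; exfalso;
  by move/eqP: p0'; apply; lra.
- move: zE; rewrite z1' mulr1; case: (F2_cases a) => ->; case: (F2_cases b) => -> /= zE;
  split=> [|_]; try (by right; split; lra); try (by apply/val_inj);
  by exfalso; lra.
- move: zE; rewrite zN1 mulrN1; case: (F2_cases a) => ->; case: (F2_cases b) => -> /= zE;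
  split=> [|_]; try (by right; split; lra); try (by apply/val_inj);
  by exfalso; lra.
Qed.

Lemma sum_mul_delta (S : pzRingType) n (c : 'I_n -> S) i :
  \sum_j c j * (i == j)%:R = c i.
Proof.
rewrite (bigD1 i)//= eqxx mulr1 big1 ?addr0// => j ji.
by rewrite eq_sym (negPf ji) mulr0.
Qed.

Section CharFun.
Variables (R : realType) (n : nat) (A : 'M['F_2]_n).

Lemma char_fun_lshift j i : char_fun A (lshift n j) i 0 = (i == j)%:R.
Proof. by rewrite mxE row_mxEl mxE. Qed.

Lemma char_fun_rshift j i :
  char_fun A (rshift n j) i 0 = (i == j)%:R + A j i.
Proof. by rewrite mxE row_mxEr !mxE. Qed.

Lemma on_facet_lshift (p : 'rV[R]_n) j : on_facet p (lshift n j) = (p 0 j == 0).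
Proof. by rewrite /on_facet (unsplitK (inl j)). Qed.

Lemma on_facet_rshift (p : 'rV[R]_n) j : on_facet p (rshift n j) = (p 0 j == 1).
Proof. by rewrite /on_facet (unsplitK (inr j)). Qed.

Lemma facet_groupD (p : 'rV[R]_n) g h : g \in facet_group A p ->
  h \in facet_group A p -> g + h \in facet_group A p.
Proof. exact: (@groupM _ (facet_group A p)). Qed.

Lemma facet_group_sum (p : 'rV[R]_n) (I : finType) (F : I -> 'cV['F_2]_n) :
  (forall i, F i \in facet_group A p) -> \sum_i F i \in facet_group A p.
Proof.
move=> Fp; elim/big_rec: _ => [|i x _ xp]; first exact: (group1 (facet_group A p)).
exact: facet_groupD.
Qed.

Lemma facet_group_char (p : 'rV[R]_n) F (c : 'F_2) : (c != 0 -> on_facet p F) ->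
  c *: char_fun A F \in facet_group A p.
Proof.
have [->|c1 /(_ isT) pF] := eqVneq c 0.
  by rewrite scale0r (group1 (facet_group A p)).
rewrite (F2_eq1 c1) scale1r; apply: mem_gen; apply/imsetP; exists F => //.
Qed.

Hypothesis Adiag : forall j, A j j = 0.

(** The elements h that work for every g form a group, so the generators suffice. A sign change at
    x_j = 0 does not move the point. Crossing x_j = 1 is a translation by 2 in coordinate j, whose
    twist supplies the summand sum_i A_ji e_i of lambda(F_(n+j)). *)
Lemma fan_facet_group (p : 'rV[R]_n) g h : h \in facet_group A p ->
  same_orbit A (fan p g) (fan p (g + h)).
Proof.
pose S := [set h | `[< forall g, same_orbit A (fan p g) (fan p (g + h)) >]]%SET.
have gS : group_set S.
  apply/group_setP; split=> [|x y]; rewrite !inE.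
    by apply/asboolP => g'; rewrite [X in g' + X](_ : _ = 0)// addr0; exact: same_orbit_refl.
  move=> /asboolP hx /asboolP hy; apply/asboolP => g'.
  rewrite [X in g' + X](_ : _ = x + y)// addrA.
  by apply: same_orbit_trans (hy _); exact: hx.
have sub : facet_group A p \subset Group gS.
  rewrite gen_subG; apply/fintype.subsetP => _ /imsetP[F pF ->].
  rewrite inE; apply/asboolP => {}g; move: (pF : on_facet p F).
  case: (split_ordP F) => j ->.
    rewrite on_facet_lshift => /eqP pj; exists 0; rewrite deck0.
    apply/rowP => i; rewrite [LHS]mxE [RHS]mxE [fun_of_matrix (_ + _) _ _]mxE.
    by rewrite char_fun_lshift; have [->|ij] := eqVneq i j; [rewrite pj !mulr0 | rewrite addr0].
  rewrite on_facet_rshift => /eqP pj.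
  (* The translation by twice this entry carries the end (-1)^(g_j) of [-1, 1] to the opposite
     end. *)
  pose k : 'rV[int]_n := \row_i (if i == j then - sg (g j 0) else 0).
  have kE i : k 0 i = if i == j then - sg (g j 0) else 0 by exact: mxE.
  exists k; apply/rowP => i.
  rewrite deckE [LHS]mxE [fan _ _ _ _]mxE [fun_of_matrix (_ + _) _ _]mxE char_fun_rshift.
  rewrite !sgD kE.
  have -> : twist A k 0 i = A j i.
    rewrite mxE (bigD1 j)//= big1 => [|l lj]; rewrite mxE kE ?(negPf lj) ?mul0r//.
    by rewrite eqxx addr0 intrN intr_sg sg_F2; case: (F2_cases (A j i)) => ->; apply/val_inj.
  have [->|ij] := eqVneq i j.
    by rewrite Adiag sg0 sg1 pj intrN intr_sg; ring.
  by rewrite sg0 mulr0 add0r mul1r; ring.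
move=> /(fintype.subsetP sub); rewrite inE => /asboolP; exact.
Qed.

Lemma fan_same_orbit (p p' : 'rV[R]_n) g g' : cube R n p -> cube R n p' ->
  same_orbit A (fan p g) (fan p' g') -> p = p' /\ g' - g \in facet_group A p.
Proof.
move=> Cp Cp' [k kE].
have kEj j : sg (g' j 0) * p' 0 j =
    2 * (k 0 j)%:~R + sg (twist A k 0 j + g j 0) * p 0 j.
  by have /rowP/(_ j) := kE; rewrite deckE !mxE sgD mulrA.
have kj j : k 0 j = 0 \/ p 0 j = 1 /\ p' 0 j = 1.
  by have [] := unit_interval_reflection (Cp j) (Cp' j) (kEj j).
have pp' : p = p'.
  apply/rowP => j; have [kj0|[-> ->]//] := kj j.
  have := kEj j; rewrite kj0 mulr0 add0r => /(congr1 Num.norm).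
  rewrite !normrM !norm_sgF2 !mul1r; have /andP[? _] := Cp j; have /andP[? _] := Cp' j.
  by rewrite !ger0_norm.
rewrite -{}pp' in kEj kj *; split=> //.
have par j : parity k 0 j = (k 0 j)%:~R by exact: mxE.
have g'E j : p 0 j != 0 -> g' j 0 = g j 0 + twist A k 0 j + parity k 0 j.
  move=> pj; have [_ ->//] := unit_interval_reflection (Cp j) (Cp j) (kEj j).
  by rewrite par; congr (_ + _); rewrite addrC.
pose c j : 'F_2 := g' j 0 + g j 0 + twist A k 0 j + parity k 0 j.
(* The deck element accounts for the facets x_j = 1, and [c] for the signs left undetermined where
   p_j = 0. *)
have -> : g' - g = \sum_j (parity k 0 j *: char_fun A (rshift n j)) +
   \sum_j (c j *: char_fun A (lshift n j)).
  apply/colP => i; rewrite !mxE !summxE.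
  rewrite (eq_bigr (fun j => parity k 0 j * (i == j)%:R + parity k 0 j * A j i)); last first.
    by move=> j _; rewrite mxE char_fun_rshift mulrDr.
  rewrite [X in _ = _ + X](eq_bigr (fun j => c j * (i == j)%:R)); last first.
    by move=> j _; rewrite mxE char_fun_lshift.
  rewrite big_split /= !sum_mul_delta.
  rewrite /c.
  have -> : \sum_j parity k 0 j * A j i = twist A k 0 i by rewrite mxE.
  by F2_case (g' i 0); F2_case (g i 0); F2_case (twist A k 0 i); F2_case (parity k 0 i); F2_decide.
apply: facet_groupD; apply: facet_group_sum => j; apply: facet_group_char.
  rewrite on_facet_rshift par; have [->|[->]//] := kj j.
  by rewrite eqxx.
rewrite on_facet_lshift; apply: contra_neqT => /g'E; rewrite /c => ->.
by F2_case (g j 0); F2_case (twist A k 0 j); F2_case (parity k 0 j); F2_decide.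
Qed.

End CharFun.

Local Open Scope classical_set_scope.

(** * Folding the line onto the unit interval *)

Section Fold.
Variable R : realType.
Implicit Types x y : R.

(** Twice this integer is an even integer nearest to [x]; the distance to it, [fold], is the
    triangle wave of period 2. *)
Definition half_round x : int := Num.floor ((x + 1) / 2).
Definition fold x := `|x - 2 * (half_round x)%:~R|.
Definition side x : 'F_2 := (x < 2 * (half_round x)%:~R)%R%:R.

Lemma half_round_bounds x :
  2 * (half_round x)%:~R - 1 <= x < 2 * (half_round x)%:~R + 1.
Proof.
have /andP[l u] := floor_itv ((x + 1) / 2); rewrite intrD in u.
by rewrite -/(half_round x) in l u; apply/andP; split; lra.
Qed.

Lemma fold_bounds x : 0 <= fold x <= 1.
Proof.
by have /andP[l u] := half_round_bounds x; rewrite normr_ge0 ler_norml; apply/andP; split; lra.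
Qed.

Lemma fold_decomp x : x = 2 * (half_round x)%:~R + sg (side x) * fold x.
Proof.
rewrite /fold /side; have [lt|le] := ltP x.
  by rewrite sg1 ltr0_norm ?subr_lt0//; ring.
by rewrite sg0 ger0_norm ?subr_ge0//; ring.
Qed.

Lemma int_lt1 (z : int) : -1 < z%:~R :> R -> z%:~R < 1 :> R -> z = 0.
Proof.
move=> h1 h2; have : (-1)%:~R < z%:~R :> R by rewrite mulrN1z.
by have : z%:~R < 1%:~R :> R by []; rewrite !ltr_int; lia.
Qed.

(** As a minimum of distances to the even integers, [fold] is 1-Lipschitz. *)
Lemma fold_le x (k : int) : fold x <= `|x - 2 * k%:~R|.
Proof.
have /andP[l u] := half_round_bounds x; have /andP[f0 f1] := fold_bounds x.
have [->//|kx] := eqVneq k (half_round x).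
have [h|h] := leP 1 `|x - 2 * k%:~R|; first exact: le_trans h.
move: h; rewrite ltr_norml => /andP[h1 h2].
case/eqP: kx; apply/eqP; rewrite -subr_eq0; apply/eqP; apply: int_lt1;
  by rewrite intrB; lra.
Qed.

Lemma fold_lipschitz x y : `|fold x - fold y| <= `|x - y|.
Proof.
suff h a b : fold a - fold b <= `|a - b|.
  by rewrite ler_norml h andbT lerNl opprB distrC h.
rewrite lerBlDr; apply: le_trans (fold_le a (half_round b)) _.
by apply: le_trans (ler_normD (a - b) (b - 2 * (half_round b)%:~R)); rewrite addrA subrK.
Qed.

(* Every closed unit cell meeting a small neighbourhood of x contains x. *)
Lemma fold_decomp_near x : exists2 d : R, 0 < d &
  forall y, `|x - y| < d -> x = 2 * (half_round y)%:~R + sg (side y) * fold x.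
Proof.
have /andP[f0 f1] := fold_bounds x; have xE := fold_decomp x.
have sgE (c : 'F_2) : sg c = (if c == 0 then 1 else -1) :> R.
  by case: (F2_cases c) => ->.
have [fx|fx] := eqVneq (fold x) 0.
  exists 1 => // y; rewrite ltr_norml => /andP[d1 d2].
  have /andP[l u] := half_round_bounds y.
  have -> : half_round y = half_round x; last by rewrite {1}xE fx !mulr0.
  apply/eqP; rewrite -subr_eq0; apply/eqP; apply: int_lt1; rewrite intrB;
  by move: xE; rewrite fx mulr0 addr0 => xE; lra.
have [fx1|fx1] := eqVneq (fold x) 1.
  exists 1 => // y; rewrite ltr_norml => /andP[d1 d2].
  have /andP[l u] := half_round_bounds y; have /andP[l' u'] := half_round_bounds x.
  have {}xE : x = 2 * (half_round x)%:~R - 1.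
    by move: xE; rewrite fx1 mulr1 sgE; case: eqP => _ xE; lra.
  rewrite fx1 mulr1 /side; case: (ltP y) => hy; rewrite ?sg1 ?sg0.
    rewrite {1}xE; congr (2 * _%:~R - 1); apply/eqP; rewrite -subr_eq0; apply/eqP.
    by apply: int_lt1; rewrite intrB; lra.
  suff : half_round x - half_round y - 1 = 0.
    by move=> /eqP; rewrite subr_eq0 subr_eq => /eqP kE; rewrite {1}xE kE intrD; lra.
  by apply: int_lt1; rewrite !intrB; lra.
have [fx0 fxl1] : 0 < fold x /\ fold x < 1.
  by rewrite !lt_neqAle f0 f1 eq_sym fx fx1.
exists (Num.min (fold x) (1 - fold x)); first by rewrite lt_min fx0 subr_gt0.
move=> y; rewrite lt_min !ltr_norml => /andP[/andP[d1 d2] /andP[d3 d4]].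
have /andP[l u] := half_round_bounds y.
have kE : half_round y = half_round x.
  apply/eqP; rewrite -subr_eq0; apply/eqP; apply: int_lt1; rewrite intrB;
  by move: xE; rewrite sgE; case: eqP => _ xE; lra.
rewrite {1}xE kE; congr (_ + sg _ * _); rewrite {2}/side kE.
move: xE; case: (F2_cases (side x)) => -> /=; rewrite ?sg0 ?sg1 => xE.
  by have /le_gtF-> : 2 * (half_round x)%:~R <= y by lra.
by have -> : y < 2 * (half_round x)%:~R by lra.
Qed.
End Fold.

(** * The small cover as the quotient of R^n by the deck group *)

Section CoverMap.
Variables (R : realType) (n : nat) (A : 'M['F_2]_n).
Implicit Types (x y : 'rV[R]_n) (a b : precover R n).

Lemma fold_in_cube x : (\row_j fold (x 0 j)) \in cube R n.
Proof. by apply/mem_set => j; rewrite mxE fold_bounds. Qed.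

Definition fold_cube x : cube R n := exist (fun y => y \in cube R n) _ (fold_in_cube x).

Lemma fold_cubeE x j : set_val (fold_cube x) 0 j = fold (x 0 j).
Proof. exact: mxE. Qed.

(** The deck transformation given by the rounded coordinates also changes signs by its twist. The
    second summand compensates for this, so that the [sheet] of the folded point lies in the orbit
    of [x]. *)
Definition fold_label x : 'cV['F_2]_n :=
  \col_j (side (x 0 j) + twist A (\row_i half_round (x 0 i)) 0 j).

Definition cover_map x : small_cover R n A :=
  cover_class A (fold_cube x, fold_label x).

Definition sheet a : 'rV[R]_n := fan (set_val a.1) a.2.

Lemma set_val_cube (p : cube R n) : cube R n (set_val p).
Proof. exact: set_valP. Qed.

(** The label comes from a second point [y] because continuity at [x] needs the labels of
    neighbouring points to represent [x] as well. *)
Lemma same_orbit_fold x y (g : 'cV['F_2]_n) : g = fold_label y ->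
  (forall j, x 0 j = 2 * (half_round (y 0 j))%:~R + sg (side (y 0 j)) * fold (x 0 j)) ->
  same_orbit A (fan (set_val (fold_cube x)) g) x.
Proof.
move=> -> xE; exists (\row_i half_round (y 0 i)); apply/rowP => j.
rewrite deckE [fan _ _ _ _]mxE fold_cubeE [X in sg X * fold _]mxE sgD.
rewrite {1}xE [fun_of_matrix (\row__ _) _ _]mxE.
by have := sg_sqr R (twist A (\row_i half_round (y 0 i)) 0 j) => s1; ring: s1.
Qed.

Lemma same_orbit_sheet x : same_orbit A (sheet (fold_cube x, fold_label x)) x.
Proof. by apply: same_orbit_fold => // j; exact: fold_decomp. Qed.

Hypothesis Adiag : forall j, A j j = 0.

Lemma cover_class_eq a b : cover_class A a = cover_class A b <->
  same_orbit A (sheet a) (sheet b).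
Proof.
split=> [/eqmodP|ab]; last apply/eqmodP.
  rewrite /= /cover_rel => /andP[/eqP ab1 ab2]; rewrite /sheet ab1 in ab2 *.
  rewrite -[X in fan _ X](subrK (b.2 : 'cV_n)) addrC.
  by apply: same_orbit_sym; exact: fan_facet_group.
have [abp abg] := fan_same_orbit (set_val_cube a.1) (set_val_cube b.1) ab.
rewrite /= cover_rel_sym /cover_rel; apply/andP; split; last by rewrite -abp.
by apply/eqP/val_inj.
Qed.

Lemma cover_map_sheet a x : same_orbit A (sheet a) x -> cover_map x = cover_class A a.
Proof.
move=> ax; apply/cover_class_eq; apply: same_orbit_trans (same_orbit_sym ax).
exact: same_orbit_sheet.
Qed.

Lemma cover_map_eq x y : cover_map x = cover_map y <-> same_orbit A x y.
Proof.
split=> [/cover_class_eq xy|xy].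
  apply: same_orbit_trans (same_orbit_sheet y).
  exact: same_orbit_trans (same_orbit_sym (same_orbit_sheet x)) xy.
apply: cover_map_sheet; apply: same_orbit_trans (same_orbit_sym xy).
exact: same_orbit_sheet.
Qed.

Lemma cover_class_reprK (X : small_cover R n A) : cover_class A (cover_repr X) = X.
Proof. exact: reprK. Qed.

Lemma cover_map_surj (X : small_cover R n A) : exists x, cover_map x = X.
Proof.
exists (sheet (cover_repr X)); rewrite -[RHS]cover_class_reprK.
by apply: cover_map_sheet; exact: same_orbit_refl.
Qed.

Lemma rV_nearP x (P : set 'rV[R]_n) : nbhs x P <->
  exists2 d : R, 0 < d & forall y, (forall j, `|x 0 j - y 0 j| < d) -> P y.
Proof.
split=> [/nbhs_ballP[d d0 dP]|[d d0 dP]].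
  exists d => // y xy; apply: dP; split=> // i j; rewrite (ord1 i); exact: xy.
apply/nbhs_ballP; exists d => // y [_ xy]; apply: dP => j; exact: xy.
Qed.

Lemma fold_cube_continuous : continuous fold_cube.
Proof.
move=> x U /nbhs_ballP[d d0 dU]; apply/rV_nearP; exists d => // y xy.
apply: dU; rewrite -initial_ballE; split=> // i j; rewrite (ord1 i) !fold_cubeE.
exact: le_lt_trans (fold_lipschitz _ _) (xy j).
Qed.

Lemma cover_class_continuous : continuous (cover_class A : precover R n -> _).
Proof. exact: pi_continuous. Qed.

(** [fold_label] jumps at the walls of the cells. Near [x], however, the label of every [y] also
    represents [x] over [fold_cube x]. For each of the finitely many labels with this property, held
    fixed, the class varies continuously with the folded point and equals [cover_map x] at [x]. *)
Lemma cover_map_continuous : continuous cover_map.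
Proof.
move=> x U Ux.
pose near_label (g : 'cV['F_2]_n) := same_orbit A (fan (set_val (fold_cube x)) g) x.
have lab : \forall y \near x, near_label (fold_label y).
  have /(_ _)/cid2-/all_sig2[d d0 dP] j := fold_decomp_near (x 0 j).
  apply/rV_nearP; exists (\big[Num.min/1]_j d j).
    by apply/bigmin_gtP; split.
  move=> y xy; apply: same_orbit_fold (erefl _) _ => j; apply: dP.
  by apply: lt_le_trans (xy j) _; exact: bigmin_le.
have sheets : \forall y \near x, forall g : 'cV['F_2]_n,
    near_label g -> U (cover_class A (fold_cube y, g)).
  apply: (@filter_forall _ 'cV['F_2]_n
    (fun g y => near_label g -> U (cover_class A (fold_cube y, g))) (nbhs x)) => g.
  have [gx|ngx] := pselect (near_label g); last by near=> y.
  have : {for x, continuous (fun y => cover_class A ((fold_cube y, g) : precover R n))}.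
    apply: (@continuous_comp _ _ _ (fun y => (fold_cube y, g) : precover R n)).
      move=> V [[P Q] /= [xP gQ] PQV].
      suff : \forall y \near x, V (fold_cube y, g) by [].
      have Px : \forall y \near x, P (fold_cube y) := @fold_cube_continuous x P xP.
      by apply: filterS Px => y Py; apply: PQV; split=> //;
        exact: nbhs_singleton.
    exact: cover_class_continuous.
  move=> /(_ U); rewrite -(@cover_map_sheet (fold_cube x, g) x gx) => /(_ Ux) Uy.
  have {Uy} Uy : \forall y \near x, U (cover_class A (fold_cube y, g)) by [].
  by apply: filterS Uy.
suff : \forall y \near x, U (cover_map y) by [].
near=> y; apply: (near sheets y) => //; exact: (near lab y).
Unshelve. all: by end_near. Qed.

Lemma sheet_near a d : 0 < d -> \forall b \near a, forall j, `|sheet a 0 j - sheet b 0 j| < d.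
Proof.
move=> d0; exists (ball a.1 d, [set a.2]) => /=.
  by split; [exact: nbhsx_ballx | exact: discrete_set1].
move=> b [/= ab1 ab2] j; rewrite /sheet !mxE ab2 -mulrBr normrM norm_sgF2 mul1r.
by move: ab1; rewrite -initial_ballE => -[_ /(_ 0 j)].
Qed.

(** Openness in the quotient is tested on representatives: a deck transformation carries [sheet a]
    into [U] and, preserving distances, carries the sheets of nearby representatives into [U]
    too. *)
Lemma cover_map_open U : open U -> open (cover_map @` U).
Proof.
move=> oU; rewrite /open /= /quotient_open openE => a [y Uy /= ya].
have /same_orbit_sym[k yE] : same_orbit A y (sheet a).
  apply/cover_map_eq; rewrite ya; apply/esym/cover_map_sheet; exact: same_orbit_refl.
have /rV_nearP[d d0 dU] : nbhs y U by exact: open_nbhs_nbhs.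
near=> b; exists (deck A k (sheet b)).
  apply: dU => j; rewrite yE deck_dist; move: j; near: b; exact: sheet_near.
rewrite -[RHS]/(cover_class A b) -(@cover_map_sheet b (sheet b)); last exact: same_orbit_refl.
by apply/cover_map_eq/same_orbit_sym; exists k.
Unshelve. all: by end_near. Qed.

End CoverMap.

(** * Lifting maps between small covers *)

Section Close.
Variables (R : realType) (n : nat).
Implicit Types x y z : 'rV[R]_n.

Definition close (d : R) x y := forall j, `|x 0 j - y 0 j| < d.

Lemma close_refl d x : 0 < d -> close d x x.
Proof. by move=> d0 j; rewrite subrr normr0. Qed.

Lemma close_sym d x y : close d x y -> close d y x.
Proof. by move=> xy j; rewrite distrC. Qed.

Lemma close_trans y d e x z : close d x y -> close e y z -> close (d + e) x z.
Proof.
move=> xy yz j; apply: le_lt_trans (ltrD (xy j) (yz j)).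
by apply: le_trans (ler_normD _ _); rewrite addrA subrK.
Qed.

Lemma close_le d e x y : d <= e -> close d x y -> close e x y.
Proof. by move=> de xy j; exact: lt_le_trans (xy j) de. Qed.

Lemma close_deck A d k x y : close d x y -> close d (deck A k x) (deck A k y).
Proof. by move=> xy j; rewrite deck_dist. Qed.

Lemma coord_bound x (d : R) : 0 < d -> exists N : nat, forall j, `|x 0 j| < N%:R * d.
Proof.
move=> d0; exists (Num.bound ((\sum_j `|x 0 j|) / d)) => j.
rewrite -ltr_pdivrMr//; apply: le_lt_trans (archi_boundP _); last first.
  by rewrite divr_ge0 ?(ltW d0)// sumr_ge0.
by rewrite ler_pM2r ?invr_gt0// (bigD1 j)//= lerDl sumr_ge0.
Qed.

(** This stands in for the connectedness of R^n: the segment from 0 to [x] is cut into steps shorter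
    than [d]. *)
Lemma close_chain (d : R) (P : 'rV[R]_n -> Prop) : 0 < d -> P 0 ->
  (forall x y, close d x y -> P x -> P y) -> forall x, P x.
Proof.
move=> d0 P0 Pd x; have [N xN] := coord_bound x d0.
have [N0|N0] := posnP N.
  by apply: Pd P0 => j; have := xN j; rewrite N0 mul0r ltNge normr_ge0.
have Pi (i : nat) : P ((i%:R / N%:R) *: x).
  elim: i => [|i IH]; first by rewrite mul0r scale0r.
  apply: Pd IH => j; rewrite !mxE distrC -mulrBl -mulrBl -natrB ?leqnSn// subSnn.
  rewrite normrM mulrC -ltr_pdivlMr; last first.
    by rewrite normr_gt0 mulf_neq0 ?invr_neq0 ?oner_neq0// pnatr_eq0 -lt0n.
  by rewrite mul1r normfV normr_nat invrK mulrC.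
by have := Pi N; rewrite divff ?scale1r// pnatr_eq0 -lt0n.
Qed.

Definition clamp (c : R) x : 'rV[R]_n := \row_j Num.max (- c) (Num.min c (x 0 j)).

Lemma clamp_close d c x y : close d x y -> close d (clamp c x) (clamp c y).
Proof.
move=> xy j; rewrite !mxE; apply: le_lt_trans (xy j).
have h1 := ler_norm (x 0 j - y 0 j); have h2 := ler_norm (y 0 j - x 0 j).
rewrite distrC in h2; rewrite ler_norml /Num.max /Num.min.
by do ![case: ifPn]; rewrite -?leNgt; lra.
Qed.

(** The displacement is at most [d]; doubling it buys the strict inequality in [close]. *)
Lemma clamp_step d c x : 0 < d -> 0 <= c -> close (d + d) (clamp c x) (clamp (c + d) x).
Proof.
move=> d0 c0 j; rewrite !mxE /Num.max /Num.min ltr_norml.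
by do ![case: ifPn]; rewrite -?leNgt; lra.
Qed.

Lemma clamp_id c x : (forall j, `|x 0 j| <= c) -> clamp c x = x.
Proof.
move=> xc; apply/rowP => j; rewrite mxE; have := xc j; rewrite ler_norml => /andP[? ?].
by rewrite min_r// max_r.
Qed.

Lemma clamp0 x : clamp 0 x = 0.
Proof.
apply/rowP => j; rewrite !mxE oppr0 /Num.max /Num.min.
by do ![case: ifPn]; rewrite -?leNgt; lra.
Qed.

End Close.

(** * Uniform lifts and the induced homomorphism of deck groups *)

Section UniformCover.
Variables (R : realType) (n m : nat) (A : 'M['F_2]_n) (B : 'M['F_2]_m).
Hypotheses (Adiag : forall j, A j j = 0) (Bdiag : forall j, B j j = 0).
Variable f : small_cover R n A -> small_cover R m B.
Hypothesis fc : continuous f.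

Let c (x : 'rV[R]_n) := f (cover_map A x).

Let near_lifts (e d : R) (x : 'rV[R]_n) := forall x', close d x x' ->
  exists y y', [/\ cover_map B y = c x, cover_map B y' = c x' & close e y y'].

Let near_lifts_local e x0 : 0 < e -> exists2 d, 0 < d &
  forall x d', close d x0 x -> d' <= d -> near_lifts e d' x.
Proof.
move=> e0; have [y0 y0E] := cover_map_surj Bdiag (c x0).
pose U := [set y : 'rV[R]_m | close (e / 2) y0 y].
have oU : open (cover_map B @` (U^°)).
  by apply: (cover_map_open Bdiag); exact: open_interior.
have cU : nbhs (c x0) (cover_map B @` (U^°)).
  apply: open_nbhs_nbhs; split=> //; exists y0 => //.
  by apply/rV_nearP; exists (e / 2) => //; rewrite divr_gt0.
have : {for x0, continuous c}.
  apply: continuous_comp; [exact: cover_map_continuous | exact: fc].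
move=> /(_ _ cU)/rV_nearP[d d0 dP].
have lift z : close d x0 z -> exists2 y, cover_map B y = c z & close (e / 2) y0 y.
  move=> /dP[y /interior_subset Uy yz]; by exists y.
exists (d / 2); first by rewrite divr_gt0.
move=> x d' xx d'd x' xx'.
have [|y yx yy] := lift x; first by apply: close_le xx; lra.
have [|y' y'x yy'] := lift x'.
  by apply: close_le (close_trans xx xx'); lra.
exists y, y'; split=> //.
by apply: close_le (close_trans (close_sym yy) yy'); lra.
Qed.

(* Compactness of [-1, 1]^n, which meets every orbit, makes this uniform. *)
Lemma uniform_lift e : 0 < e -> exists2 d, 0 < d & forall x x' y, close d x x' ->
  cover_map B y = f (cover_map A x) ->
  exists2 y', cover_map B y' = f (cover_map A x') & close e y y'.
Proof.
move=> e0; pose K := [set x : 'rV[R]_n | forall j, `[(-1 : R), 1] (x ord0 j)].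
have cK : compact K by apply: (@rV_compact _ _ (fun=> `[(-1 : R), 1])) => _; exact: segment_compact.
have : \forall d \near 0^'+, K `<=` near_lifts e d.
  move/compact_near_coveringP: cK; apply=> x0 _.
  have [d d0 dP] := near_lifts_local x0 e0.
  near=> x d' => /=; apply: dP; last by near: d'; exact: nbhs_right_le.
  near: x; apply/rV_nearP; by exists d.
move=> /(filterI (@nbhs_right_gt R 0))/filter_ex[d [/= d0 dK]].
exists d => // x x' y xx' yx.
have [k kK] : exists k, K (deck A k x).
  have [k kE] := same_orbit_sym (same_orbit_sheet A x); exists k.
  rewrite -kE => j /=; rewrite in_itv/= -ler_norml [sheet _ _ _]mxE normrM norm_sgF2 mul1r.
  by have /andP[p0 p1] := set_val_cube (fold_cube x) j; rewrite ger0_norm.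
have ck z : f (cover_map A (deck A k z)) = f (cover_map A z).
  by congr f; apply/(cover_map_eq Adiag)/same_orbit_sym; exists k.
have [y1 [y1' []]] := dK _ kK _ (close_deck A k xx').
rewrite /c !ck => y1E y1'E yy.
(* The lift found so far starts at an arbitrary point of the fibre; a deck transformation moves it
   to the prescribed [y] without changing distances. *)
have /(cover_map_eq Bdiag)[l ->] : cover_map B y1 = cover_map B y by rewrite yx.
exists (deck B l y1'); last exact: close_deck.
by rewrite -y1'E; apply/(cover_map_eq Bdiag)/same_orbit_sym; exists l.
Unshelve. all: by end_near. Qed.

Variable r : 'I_m -> nat.
Hypothesis rB : ranked r B.

Lemma deck_inj k l (y : 'rV[R]_m) : deck B k y = deck B l y -> k = l.
Proof.
move=> kl; have : deck_mul B (deck_inv B k) l = 0.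
  apply: (deck_free (x := y) rB) => j.
  by rewrite -deckM -kl deck_invK subrr normr0.
move/rowP => h; apply/rowP => j; have := h j.
rewrite [RHS]mxE deck_mulE twist_deck_inv deck_invE addrC => /eqP.
rewrite subr_eq0 => /eqP /(congr1 ( *%R (sg (twist B k 0 j)))).
by rewrite !mulrA sg_sqr !mul1r.
Qed.

(** By [deck_free], distinct points of a fibre are at least 2 apart in some coordinate. This is the
    bound under which all comparisons of lifts have to stay. *)
Lemma close_lifts_eq (y y' : 'rV[R]_m) : cover_map B y = cover_map B y' ->
  close 2 y y' -> y = y'.
Proof.
move=> /(cover_map_eq Bdiag)[k ->] yk; suff -> : k = 0 by rewrite deck0.
by apply: (deck_free (x := y) rB) => j; rewrite distrC.
Qed.

(** Uniform continuity is demanded because lifts are compared along chains with steps of one fixed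
    size. *)
Definition uniform_lifting (F : 'rV[R]_n -> 'rV[R]_m) :=
  (forall x, cover_map B (F x) = f (cover_map A x)) /\
  (forall e, 0 < e -> exists2 d, 0 < d & forall x x', close d x x' -> close e (F x) (F x')).

(** A deck transformation matches the two lifts at 0. Agreement then spreads in steps along which
    each lift moves by less than 1, so that together they stay under the separation 2 of a fibre. *)
Lemma lifting_unique (F G : 'rV[R]_n -> 'rV[R]_m) :
  uniform_lifting F -> uniform_lifting G -> exists k, forall x, G x = deck B k (F x).
Proof.
move=> [Fl /(_ _ ltr01)[dF dF0 dFP]] [Gl /(_ _ ltr01)[dG dG0 dGP]].
have /(cover_map_eq Bdiag)[k kE] : cover_map B (F 0) = cover_map B (G 0) by rewrite Fl Gl.
exists k; apply: (@close_chain _ _ (Num.min dF dG)) => //; first by rewrite lt_min dF0.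
move=> x x' xx' Gx; apply: close_lifts_eq.
  by rewrite Gl -Fl; apply/(cover_map_eq Bdiag); exists k.
have -> : 2 = 1 + 1 :> R by [].
apply: (close_trans (y := G x)).
  by apply: close_sym; apply: dGP; apply: close_le xx'; rewrite ge_min lexx orbT.
rewrite Gx; apply: close_deck; apply: dFP; apply: close_le xx'.
by rewrite ge_min lexx.
Qed.

(* The lift is continued along the clamps onto the cubes [-k d, k d]^n; any two
   lifts that are close together coincide, so no gluing is needed. *)
Lemma lifting_exists : exists F, uniform_lifting F.
Proof.
(* Comparing consecutive stages at two close points passes through four displacements below 1/4, in
   total below 2. *)
have [|d dd0 dP] := @uniform_lift 4^-1; first by rewrite invr_gt0.
pose d2 := d / 2; have d20 : 0 < d2 by rewrite divr_gt0.
have [y0 y0E] := cover_map_surj Bdiag (c 0).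
pose next (x' : 'rV[R]_n) (y : 'rV[R]_m) : 'rV[R]_m :=
  xget y [set y' | cover_map B y' = c x' /\ close 4^-1 y y'].
have nextP x x' y : close d x x' -> cover_map B y = c x ->
    cover_map B (next x' y) = c x' /\ close 4^-1 y (next x' y).
  move=> xx' yx; have [y' y'E yy'] := dP _ _ _ xx' yx.
  by apply: (@xgetPex _ _ [set y' | cover_map B y' = c x' /\ close 4^-1 y y']); exists y'.
pose cl (k : nat) (x : 'rV[R]_n) := clamp (k%:R * d2) x.
pose G := fix G (k : nat) (x : 'rV[R]_n) : 'rV[R]_m :=
  if k is k'.+1 then next (cl k x) (G k' x) else y0.
have clS k x : close d (cl k x) (cl k.+1 x).
  rewrite /cl -natr1 mulrDl mul1r (_ : d = d2 + d2); last by rewrite /d2; lra.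
  by apply: clamp_step => //; rewrite mulr_ge0// ltW.
have Gl k x : cover_map B (G k x) = c (cl k x).
  elim: k => [|k IH]; first by rewrite /cl mul0r clamp0.
  by have [] := nextP _ _ _ (clS k x) IH.
have GS k x : close 4^-1 (G k x) (G k.+1 x).
  by have [] := nextP _ _ _ (clS k x) (Gl k x).
have Gu k x x' : close d x x' -> close 4^-1 (G k x) (G k x').
  move=> xx'; elim: k => [|k IH]; first by apply: close_refl; rewrite invr_gt0.
  have [y' y'E yy'] := dP _ _ _ (clamp_close (k.+1%:R * d2) xx') (Gl k.+1 x).
  suff -> : G k.+1 x' = y' by [].
  apply: close_lifts_eq; first by rewrite Gl.
  apply: close_le (close_trans (close_trans (close_sym (GS k x')) (close_sym IH))
    (close_trans (GS k x) yy')).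
  by lra.
(* From stage [N x] on the clamp fixes [x], and the value of [G] at [x] no longer changes. *)
pose N (x : 'rV[R]_n) := sval (cid (coord_bound x d20)).
have clN x k : (N x <= k)%N -> cl k x = x.
  move=> Nk; apply: clamp_id => j; apply: le_trans (ltW (svalP (cid (coord_bound x d20)) j)) _.
  by rewrite ler_pM2r// ler_nat.
have GN x k : (N x <= k)%N -> G k x = G (N x) x.
  elim: k => [|k IH]; first by rewrite leqn0 => /eqP->.
  rewrite leq_eqVlt => /orP[/eqP-> //|Nk]; rewrite -IH//.
  apply: close_lifts_eq; first by rewrite !Gl !clN// ltnW.
  by apply: close_sym; apply: close_le (GS k x); lra.
exists (fun x => G (N x) x); split=> [x|e e0]; first by rewrite Gl clN.
have Fu x x' : close d x x' -> close 4^-1 (G (N x) x) (G (N x') x').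
  move=> xx'; rewrite -(@GN x (maxn (N x) (N x')))  ?leq_maxl//.
  by rewrite -(@GN x' (maxn (N x) (N x'))) ?leq_maxr//; exact: Gu.
(* The cap at 1 keeps 1/4 + min(e, 1) below 2, which identifies the close lift obtained here with
   the value of the constructed lift. *)
have [|d1 d10 d1P] := @uniform_lift (Num.min e 1); first by rewrite lt_min e0 ltr01.
exists (Num.min d d1); first by rewrite lt_min dd0.
move=> x x' xx'.
have [||y' y'E yy'] := d1P x x' (G (N x) x).
- by apply: close_le xx'; rewrite ge_min lexx orbT.
- by rewrite Gl clN.
suff -> : G (N x') x' = y' by apply: close_le yy'; rewrite ge_min lexx.
apply: close_lifts_eq; first by rewrite Gl clN.
have xx'd : close d x x' by apply: close_le xx'; rewrite ge_min lexx.
apply: (@close_le _ _ (4^-1 + Num.min e 1)); last exact: close_trans (close_sym (Fu _ _ xx'd)) yy'.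
have : Num.min e 1 <= 1 by rewrite ge_min lexx orbT.
by lra.
Qed.

(** Precomposition with a deck transformation yields another lift of the same map, hence a translate
    of [F] by a deck transformation of the target. Freeness makes the latter unique, and so [phi]
    multiplicative. *)
Lemma lifting_deck F : uniform_lifting F ->
  exists phi : 'rV[int]_n -> 'rV[int]_m,
    (forall k x, F (deck A k x) = deck B (phi k) (F x)) /\
    (forall k l, phi (deck_mul A k l) = deck_mul B (phi k) (phi l)).
Proof.
move=> FL; have FkL k : uniform_lifting (F \o deck A k).
  case: FL => Fl Fu; split=> [x|e e0] /=.
    rewrite Fl; congr f; apply/(cover_map_eq Adiag)/same_orbit_sym; by exists k.
  have [d d0 dP] := Fu _ e0; exists d => // x x' xx'; apply: dP; exact: close_deck.
pose phi k := sval (cid (lifting_unique FL (FkL k))).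
have phiE k x : F (deck A k x) = deck B (phi k) (F x).
  exact: (svalP (cid (lifting_unique FL (FkL k))) x).
exists phi; split=> // k l; apply: (@deck_inj _ _ (F 0)).
by rewrite -phiE -deckM phiE phiE deckM.
Qed.

End UniformCover.

(** * Quadratic functions on the deck group *)

Definition deck_morphism n m (A : 'M['F_2]_n) (B : 'M['F_2]_m)
    (phi : 'rV[int]_n -> 'rV[int]_m) :=
  forall k l, phi (deck_mul A k l) = deck_mul B (phi k) (phi l).

Lemma intr_F2_abs (z : int) : (z%:~R : 'F_2) = (`|z|%N)%:R.
Proof.
case: z => z //; rewrite NegzE intrN abszN.
have oppE (a : 'F_2) : - a = a by case: (F2_cases a) => ->; apply/val_inj.
exact: oppE.
Qed.

Section DeckForms.
Variables (n : nat) (A : 'M['F_2]_n).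
Hypothesis Adiag : forall j, A j j = 0.
Implicit Types k l : 'rV[int]_n.

Definition axis (c : int) (i : 'I_n) : 'rV[int]_n := \row_j (if j == i then c else 0).

Lemma twist_axis c i j : twist A (axis c i) 0 j = c%:~R * A i j.
Proof.
rewrite mxE (bigD1 i)//= !mxE eqxx big1 ?addr0// => l li.
by rewrite !mxE (negPf li) mul0r.
Qed.

Lemma deck_mul_axis c d i : deck_mul A (axis c i) (axis d i) = axis (c + d) i.
Proof.
apply/rowP => j; rewrite deck_mulE twist_axis !mxE.
by have [->|_] := eqVneq j i; rewrite ?Adiag mulr0 ?sg0 ?mul1r ?addr0.
Qed.

Lemma axis0 i : axis 0 i = 0.
Proof. by apply/rowP => j; rewrite !mxE if_same. Qed.

Lemma deck_mul0 k : deck_mul A 0 k = k.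
Proof. by apply/rowP => j; rewrite deck_mulE twist0 !mxE sg0 mul1r add0r. Qed.

Section Additive.
Variable h : 'rV[int]_n -> 'F_2.
Hypothesis hM : forall k l, h (deck_mul A k l) = h k + h l.

Let h0 : h 0 = 0.
Proof. by have := hM 0 0; rewrite deck_mul0 F2_addrr. Qed.

Let h_axis c i : h (axis c i) = c%:~R * h (axis 1 i).
Proof.
have hnat (p : nat) : h (axis p i) = p%:R * h (axis 1 i).
  elim: p => [|p IH]; first by rewrite axis0 h0 mul0r.
  by rewrite intS addrC -deck_mul_axis hM IH -natr1 mulrDl mul1r.
rewrite intr_F2_abs; case: c => p; first exact: hnat.
rewrite NegzE abszN -hnat; apply: F2_addr_eq0.
by rewrite -hM deck_mul_axis addNr axis0.
Qed.

(** Homomorphisms to F_2 factor through the parity: [k] is assembled one coordinate at a time from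
    elements on the axes, where [h] depends only on the length mod 2. *)
Lemma deck_additive k : h k = \sum_i parity k 0 i * h (axis 1 i).
Proof.
pose kt t : 'rV[int]_n := \row_i (if (i < t)%N then k 0 i else 0).
suff ht t : (t <= n)%N -> h (kt t) = \sum_(i < n | (i < t)%N) parity k 0 i * h (axis 1 i).
  rewrite (_ : k = kt n); last by apply/rowP => i; rewrite mxE ltn_ord.
  rewrite ht//; apply: eq_big => i; first exact: ltn_ord.
  by move=> _; congr (_ * _); rewrite !mxE ltn_ord.
elim: t => [_|t IH tn].
  by rewrite big1// (_ : kt 0 = 0) ?h0//; apply/rowP => i; rewrite !mxE ltn0.
pose i0 := Ordinal tn.
have ltS (i : 'I_n) : (i < t.+1)%N = (i == i0) || (i < t)%N.
  by rewrite ltnS leq_eqVlt -val_eqE.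
(* The sign cancels the twist that [kt t] exerts on the new coordinate. *)
have -> : kt t.+1 = deck_mul A (kt t) (axis (sg (twist A (kt t) 0 i0) * k 0 i0) i0).
  apply/rowP => i; rewrite deck_mulE [axis _ _ _ _]mxE [kt t.+1 _ _]mxE [kt t _ _]mxE.
  rewrite ltS; have [->|_] := eqVneq i i0; first by rewrite ltnn add0r mulrA sg_sqr mul1r.
  by rewrite mulr0 addr0.
rewrite hM IH 1?ltnW// h_axis intrM intr_sg sg_F2 mul1r.
rewrite [RHS](bigD1 i0)//= addrC mxE; congr (_ + _).
apply: eq_bigl => i; rewrite ltS.
by have [->|] := eqVneq i i0; rewrite ?ltnn ?andbT ?andbF.
Qed.

End Additive.

Lemma deck_morphism_parity m (B : 'M['F_2]_m) phi : deck_morphism A B phi ->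
  exists P : 'M['F_2]_(n, m), forall k, parity (phi k) = parity k *m P.
Proof.
move=> phiM; exists (\matrix_(i, j) parity (phi (axis 1 i)) 0 j) => k.
apply/rowP => j; rewrite [RHS]mxE.
rewrite (@deck_additive (fun k => parity (phi k) 0 j)) => [|k' l]; last first.
  by rewrite phiM parity_deck_mul mxE.
by apply: eq_bigr => i _; congr (_ * _); rewrite [RHS]mxE.
Qed.

(** If A_ji = 0, the unit elements satisfy e_i e_j = e_j^s e_i with s = (-1)^(A_ij). Evaluating [h]
    on both sides gives the relation: passing from e_j to its inverse changes [h] by M_jj, which is
    the origin of the term A_ij M_jj. *)
Lemma quadratic_relation_deck r (M : 'M['F_2]_n) (h : 'rV[int]_n -> 'F_2) :
  ranked r A ->
  (forall k l, h (deck_mul A k l) =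
     h k + h l + \sum_i \sum_j parity k 0 i * M i j * parity l 0 j) ->
  quadratic_relation A M.
Proof.
move=> rA hM.
have axisE c d i j : h (deck_mul A (axis c i) (axis d j)) =
    h (axis c i) + h (axis d j) + c%:~R * M i j * d%:~R.
  rewrite hM; congr (_ + _); rewrite (bigD1 i)//= (bigD1 j)//= !mxE !eqxx.
  rewrite !big1 ?addr0// => [i' ii'|j' jj'].
    by rewrite big1// => j' _; rewrite !mxE (negPf ii') !mul0r.
  by rewrite !mxE (negPf jj') mulr0.
have h0 : h 0 = 0.
  have := hM 0 0; rewrite deck_mul0 big1 => [|i _]; first by rewrite addr0 F2_addrr.
  by rewrite big1// => j _; rewrite parity0 mxE !mul0r.
have hN j : h (axis (-1) j) = h (axis 1 j) + M j j.
  have := axisE 1 (-1) j j; rewrite deck_mul_axis subrr axis0 h0.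
  rewrite mulrN1z mulr1z mul1r.
  by F2_case (h (axis 1 j)); F2_case (h (axis (-1) j)); F2_case (M j j); F2_decide.
have main i j : i != j -> A j i = 0 -> M i j + M j i = A i j * M j j.
  move=> ij Aji.
  have comm : deck_mul A (axis 1 i) (axis 1 j) =
      deck_mul A (axis (sg (A i j)) j) (axis 1 i).
    apply/rowP => l; rewrite !deck_mulE !twist_axis !mxE.
    have [->|li] := eqVneq l i.
      by rewrite (negPf ij) Aji !mulr0 sg0 addr0 add0r mulr1.
    by have [->|_] := eqVneq l j; rewrite ?mulr1z ?mul1r ?mulr1 ?mulr0 ?addr0 ?add0r.
  have := axisE 1 1 i j; rewrite comm axisE intr_sg sg_F2 mulr1z mul1r mulr1.
  case: (F2_cases (A i j)) => ->; rewrite ?sg0 ?sg1 ?hN ?mul1r ?mul0r;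
  by F2_case (h (axis 1 j)); F2_case (h (axis 1 i)); F2_case (M j j);
    F2_case (M i j); F2_case (M j i); F2_decide.
move=> i j ij; have /eqP := ranked_2cycle i j rA.
rewrite mulf_eq0 => /orP[]/eqP A0; rewrite A0 mul0r ?addr0 ?add0r; last exact: main.
by rewrite addrC main// eq_sym.
Qed.

End DeckForms.

(* The carry into the second binary digit makes the products (x_j + alpha_j) x_j
   coboundaries. *)
Definition half_bit (z : int) : 'F_2 := (z %/ 2)%Z%:~R.

(** Modulo 2, y z is the carry when the last binary digits are added (a = 0), and (y + 1) z is the
    borrow when they are subtracted (a = 1). *)
Lemma half_bit_sg (a : 'F_2) (y z : int) :
  half_bit (y + sg a * z) = half_bit y + half_bit z + (y%:~R + a) * z%:~R.
Proof.
have dec (w : int) : exists q (b : bool), w = q * 2 + b%:Z.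
  exists (w %/ 2)%Z, ((w %% 2)%Z != 0); rewrite {1}(divz_eq w 2); congr (_ + _).
  have := modz_ge0 w (isT : 2 != 0 :> int); have := ltz_pmod w (isT : 0 < 2 :> int).
  by case: (w %% 2)%Z => [[|[|]]|].
have hb q (b : bool) : half_bit (q * 2 + b%:Z) = q%:~R.
  by rewrite /half_bit divzMDl// divz_small ?addr0//; case: b.
have par q (b : bool) : (q * 2 + b%:Z)%:~R = b%:R :> 'F_2.
  by rewrite intrD intrM (_ : 2%:~R = 0) ?mulr0 ?add0r//; apply/val_inj.
have [p [b ->]] := dec y; have [q [c ->]] := dec z; rewrite !hb !par.
case: (F2_cases a) => ->; rewrite ?sg0 ?sg1.
  rewrite (_ : p * 2 + b%:Z + 1 * (q * 2 + c%:Z) = (p + q + (b && c)%:Z) * 2 + (b (+) c)%:Z); last first.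
    by rewrite ?mul1r ?mulN1r; case: b; case: c; rewrite /=; lia.
  by rewrite hb !intrD; case: b; case: c; rewrite /= ?(mulr0, mul0r, addr0, mulr1).
rewrite (_ : p * 2 + b%:Z + -1 * (q * 2 + c%:Z) = (p - q - (~~ b && c)%:Z) * 2 + (b (+) c)%:Z); last first.
    by rewrite ?mul1r ?mulN1r; case: b; case: c; rewrite /=; lia.
rewrite hb !intrB; move: (p%:~R) (q%:~R) => x w.
by F2_case x; F2_case w; case: b; case: c; apply/val_inj.
Qed.

(** The form is the coboundary of the function sending k to [half_bit] of coordinate j of
    [phi k]. *)
Lemma deck_morphism_relations n m (A : 'M['F_2]_n) (B : 'M['F_2]_m) r phi
    (P : 'M['F_2]_(n, m)) :
  ranked r A -> deck_morphism A B phi ->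
  (forall k, parity (phi k) = parity k *m P) ->
  forall j, quadratic_relation A
    (\matrix_(i, l) ((P i j + (P *m B) i j) * P l j)).
Proof.
move=> rA phiM phiP j.
apply: (quadratic_relation_deck (h := fun k => half_bit (phi k 0 j)) _ rA).
  by move=> i; exact: ranked_diag rA.
move=> k l; rewrite phiM deck_mulE half_bit_sg; congr (_ + _).
have parE k' : (phi k' 0 j)%:~R = \sum_i parity k' 0 i * P i j.
  by have /rowP/(_ j) := phiP k'; rewrite !mxE.
rewrite !parE /twist phiP -mulmxA [fun_of_matrix (_ *m _) _ _]mxE -big_split mulr_suml.
apply: eq_bigr => i _; rewrite mulr_sumr; apply: eq_bigr => i' _.
by rewrite [in RHS](mxE _ (fun i l => (P i j + (P *m B) i j) * P l j)) /=; ring.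
Qed.

(** * From homeomorphisms to matrix operations *)

Section Homeomorphic.
Variable R : realType.

(** [G \o F] lifts the identity, hence is a deck transformation. So [psi] after [phi] is a
    conjugation, which is invisible in the parities. *)
Lemma lifted_parity n m (A : 'M['F_2]_n) (B : 'M['F_2]_m) rA rB
    (f : small_cover R n A -> small_cover R m B)
    (g : small_cover R m B -> small_cover R n A)
    (F : 'rV[R]_n -> 'rV[R]_m) (G : 'rV[R]_m -> 'rV[R]_n) phi psi
    (P : 'M['F_2]_(n, m)) (Q : 'M['F_2]_(m, n)) :
  ranked rA A -> ranked rB B -> cancel f g ->
  uniform_lifting f F -> uniform_lifting g G ->
  (forall k x, F (deck A k x) = deck B (phi k) (F x)) ->
  (forall k x, G (deck B k x) = deck A (psi k) (G x)) ->
  (forall k, parity (phi k) = parity k *m P) ->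
  (forall k, parity (psi k) = parity k *m Q) ->
  P *m Q = 1%:M.
Proof.
move=> rkA rkB fg [Fl Fu] [Gl Gu] phiE psiE phiP psiQ.
have idL : uniform_lifting (id : small_cover R n A -> _) id.
  by split=> // e e0; exists e.
have GFL : uniform_lifting (id : small_cover R n A -> _) (G \o F).
  split=> [x|e e0] /=; first by rewrite Gl Fl fg.
  have [d d0 dP] := Gu _ e0; have [d' d'0 d'P] := Fu _ d0.
  by exists d' => // x x' xx'; apply: dP; exact: d'P.
have [|k kE] := lifting_unique _ rkA idL GFL; first by move=> j; exact: ranked_diag rkA.
have par l : parity l = parity l *m (P *m Q).
  have : deck_mul A k l = deck_mul A (psi (phi l)) k.
    apply: (deck_inj rkA (y := 0 : 'rV[R]_n)).
    have {}kE x : G (F x) = deck A k x by exact: kE.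
    by rewrite -!deckM -!kE phiE psiE.
  move=> /(congr1 (@parity n)); rewrite !parity_deck_mul psiQ phiP mulmxA addrC.
  exact: addIr.
apply/row_matrixP => i; rewrite rowE [RHS]rowE mulmx1.
have -> : delta_mx 0 i = parity (axis 1 i).
  by apply/rowP => j; rewrite !mxE eqxx; case: eqP.
exact/esym/par.
Qed.

Lemma homeomorphic_reachable n m (A : 'M['F_2]_n) (B : 'M['F_2]_m) rA rB
    (f : small_cover R n A -> small_cover R m B)
    (g : small_cover R m B -> small_cover R n A) :
  ranked rA A -> ranked rB B -> continuous f -> continuous g ->
  cancel f g -> cancel g f ->
  exists2 A', mx_reachable A A' & exists2 h : 'I_m -> 'I_n, bijective h &
    forall i j, B i j = A' (h i) (h j).
Proof.
move=> rkA rkB fc gc fg gf.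
have Ad j : A j j = 0 by exact: ranked_diag rkA.
have Bd j : B j j = 0 by exact: ranked_diag rkB.
have [F FL] := lifting_exists Ad Bd fc rkB.
have [G GL] := lifting_exists Bd Ad gc rkA.
have [phi [phiE phiM]] := lifting_deck Ad Bd rkB FL.
have [psi [psiE psiM]] := lifting_deck Bd Ad rkA GL.
have [P phiP] := deck_morphism_parity Ad phiM.
have [Q psiQ] := deck_morphism_parity Bd psiM.
have PQ := lifted_parity rkA rkB fg FL GL phiE psiE phiP psiQ.
have QP := lifted_parity rkB rkA gf GL FL psiE phiE psiQ phiP.
have nm : n = m by apply/eqP; rewrite eqn_leq (mulmx1_min PQ) (mulmx1_min QP).
move: B rB f g fc gc fg gf rkB Bd F FL G GL phi phiE phiM psi psiE psiM P phiP Q psiQ PQ QP.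
rewrite -{}nm => B rB _ _ _ _ _ _ rkB _ _ _ _ _ phi _ phiM psi _ _ P phiP Q _ PQ _.
have [Pu _] := mulmx1_unit PQ.
have [s sA] := relations_reachable rkA rkB Pu (deck_morphism_relations rkA phiM phiP).
exists (\matrix_(i, j) B (s i) (s j)) => //; exists (s^-1)%g.
  by exists s; [exact: permKV | exact: permK].
by move=> i j; rewrite mxE !permKV.
Qed.

End Homeomorphic.

(** * Affine equivalences of deck groups *)

Section Affine.
Variable R : realType.

Definition affine n m (F : 'rV[R]_n -> 'rV[R]_m) :=
  exists (L : 'M[R]_(n, m)) b, forall x, F x = x *m L + b.

Lemma affine_comp n m p (F : 'rV[R]_n -> 'rV[R]_m) (G : 'rV[R]_m -> 'rV[R]_p) :
  affine F -> affine G -> affine (G \o F).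
Proof.
move=> [L [b FE]] [L' [b' GE]]; exists (L *m L'), (b *m L' + b') => x /=.
by rewrite GE FE mulmxDl mulmxA addrA.
Qed.

Lemma affine_coord n m (h : 'I_m -> 'I_n) (c d : 'I_m -> R) :
  affine (fun x : 'rV[R]_n => \row_j (c j + d j * x 0 (h j))).
Proof.
exists (\matrix_(i, j) (d j * (h j == i)%:R)), (\row_j c j) => x.
apply/rowP => j; rewrite !mxE addrC; congr (_ + _).
rewrite (eq_bigr (fun i => (x 0 i * d j) * (h j == i)%:R)) => [|i _].
  by rewrite sum_mul_delta mulrC.
by rewrite !mxE mulrA.
Qed.

Lemma affine_deck n (A : 'M['F_2]_n) k : affine (deck A k : 'rV[R]_n -> _).
Proof. exact: (affine_coord id). Qed.

Lemma parityD n (k l : 'rV[int]_n) i :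
  parity (k + l) 0 i = parity k 0 i + parity l 0 i.
Proof. by rewrite !mxE intrD. Qed.

Definition preserves_orbits n m (A : 'M['F_2]_n) (B : 'M['F_2]_m) (F : 'rV[R]_n -> 'rV[R]_m) :=
  forall x y, same_orbit A x y -> same_orbit B (F x) (F y).

Definition affine_equivalent n m (A : 'M['F_2]_n) (B : 'M['F_2]_m) :=
  exists (F : 'rV[R]_n -> 'rV[R]_m) (G : 'rV[R]_m -> 'rV[R]_n),
  [/\ cancel F G, cancel G F, affine F /\ affine G,
      preserves_orbits A B F & preserves_orbits B A G].

Lemma affine_equivalent_trans n m p (A : 'M['F_2]_n) (B : 'M['F_2]_m) (C : 'M['F_2]_p) :
  affine_equivalent A B -> affine_equivalent B C -> affine_equivalent A C.
Proof.
move=> [F [G [FG GF [aF aG] oF oG]]] [F' [G' [FG' GF' [aF' aG'] oF' oG']]].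
exists (F' \o F), (G \o G'); split.
- exact: can_comp FG' FG.
- exact: can_comp GF GF'.
- by split; exact: affine_comp.
- by move=> x y /oF/oF'.
- by move=> x y /oG'/oG.
Qed.

Lemma affine_equivalent_refl n (A : 'M['F_2]_n) : affine_equivalent A A.
Proof.
have aid : affine (id : 'rV[R]_n -> 'rV[R]_n).
  by exists 1%:M, 0 => x; rewrite mulmx1 addr0.
by exists id, id; split.
Qed.

(** The trivial coefficients in [0 + 1 * _] make the map an instance of [affine_coord]. *)
Lemma preserves_orbits_relabel n m (A : 'M['F_2]_n) (B : 'M['F_2]_m) (h : 'I_m -> 'I_n) :
  bijective h -> (forall i j, B i j = A (h i) (h j)) ->
  preserves_orbits A B (fun x => \row_j (0 + 1 * x 0 (h j))).
Proof.
move=> bh hB x _ [k ->]; exists (\row_j k 0 (h j)); apply/rowP => j.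
rewrite [LHS]mxE !deckE [in RHS]mxE [fun_of_matrix (\row__ (0 + _)) _ _]mxE.
rewrite !add0r !mul1r; congr (_ + sg _ * _); rewrite !mxE.
rewrite (reindex h) /=; last exact: onW_bij.
by apply: eq_bigr => i _; rewrite !mxE hB.
Qed.

Lemma affine_equivalent_relabel n m (A : 'M['F_2]_n) (B : 'M['F_2]_m) (h : 'I_m -> 'I_n) :
  bijective h -> (forall i j, B i j = A (h i) (h j)) -> affine_equivalent A B.
Proof.
move=> bh hB; have [h' hK h'K] := bh.
exists (fun x => \row_j (0 + 1 * x 0 (h j))), (fun x => \row_j (0 + 1 * x 0 (h' j))).
split.
- by move=> x; apply/rowP => j; rewrite !mxE h'K !add0r !mul1r.
- by move=> x; apply/rowP => j; rewrite !mxE hK !add0r !mul1r.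
- by split; apply: affine_coord.
- exact: preserves_orbits_relabel.
- apply: preserves_orbits_relabel; first by exists h.
  by move=> i j; rewrite hB !h'K.
Qed.

Variables (n : nat).
Implicit Types A : 'M['F_2]_n.

Definition shift_coord (v : 'I_n) (c : R) (x : 'rV[R]_n) : 'rV[R]_n :=
  \row_j ((if j == v then c else 0) + 1 * x 0 j).

Lemma preserves_orbits_shift A v (a : 'F_2) : A v v = 0 ->
  preserves_orbits A (mx_local_complement v A A) (shift_coord v (sg a)).
Proof.
move=> Av x _ [k ->].
pose t := twist A k 0 v.
(* Conjugating x_v |-> 2 k_v + (-1)^t x_v by the translation by c = (-1)^a changes 2 k_v by c -
   (-1)^t c = 2 t c. *)
pose u : 'rV[int]_n := \row_j (if j == v then sg a * (t : nat)%:Z else 0).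
have uE i : parity u 0 i = t * (i == v)%:R.
  rewrite [LHS]mxE [u 0 i]mxE; have [_|_] := eqVneq i v; last by rewrite mulr0.
  rewrite intrM intr_sg sg_F2 mul1r mulr1; by case: (F2_cases t) => ->; apply/val_inj.
(* Row v of A enters t times through [u] and t = (kA)_v times through the complementation; the two
   contributions cancel. *)
have twE : twist (mx_local_complement v A A) (k + u) = twist A k.
  apply/rowP => j; rewrite mxE (eq_bigr (fun i => parity k 0 i * A i j +
    (parity k 0 i * A i v * A v j + (t * (A i j + A i v * A v j)) * (v == i)%:R))); last first.
    move=> i _; rewrite parityD uE -[mx_local_complement _ _ _]/(\matrix_(_, _) _).
    by rewrite [fun_of_matrix (\matrix_(_, _) _) _ _]mxE [v == i]eq_sym; ring.
  rewrite big_split big_split /= sum_mul_delta -mulr_suml Av mul0r addr0.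
  have tE z : \sum_i parity k 0 i * A i z = twist A k 0 z by rewrite mxE.
  by rewrite !tE -/t F2_addrr addr0.
exists (k + u); apply/rowP => j; rewrite deckE twE [LHS]mxE [shift_coord _ _ _ _ _]mxE.
rewrite deckE [fun_of_matrix (k + u) _ _]mxE intrD [u 0 j]mxE.
have [->|_] := eqVneq j v; last by rewrite !add0r !mul1r mulr0z addr0.
rewrite -/t intrM intr_sg; case: (F2_cases t) => ->; rewrite ?sg0 ?sg1.
  by rewrite [(nat_of_ord 0)%:~R](_ : _ = 0)//; ring.
by rewrite [(nat_of_ord 1)%:~R](_ : _ = 1)//; ring.
Qed.

Lemma affine_equivalent_local_complement A r v : ranked r A ->
  affine_equivalent A (mx_local_complement v A A).
Proof.
move=> rA; have Av := ranked_diag v rA; have rA' := ranked_local_complement v rA.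
exists (shift_coord v (sg 0)), (shift_coord v (sg 1)); split.
- by move=> x; apply/rowP => j; rewrite !mxE; case: eqP => _; rewrite ?sg0 ?sg1; ring.
- by move=> x; apply/rowP => j; rewrite !mxE; case: eqP => _; rewrite ?sg0 ?sg1; ring.
- by split; exact: (affine_coord id).
- exact: preserves_orbits_shift.
- rewrite -{3}(mx_local_complementK Av); apply: preserves_orbits_shift.
  exact: ranked_diag rA'.
Qed.

Definition shear_coord (v w : 'I_n) (c : R) (x : 'rV[R]_n) : 'rV[R]_n :=
  \row_j (x 0 j + (if j == v then c * x 0 w else 0)).

Lemma affine_shear v w c : affine (shear_coord v w c).
Proof.
exists (\matrix_(i, j) ((i == j)%:R + (if j == v then c else 0) * (w == i)%:R)), 0.
move=> x; rewrite addr0; apply/rowP => j; rewrite !mxE.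
rewrite (eq_bigr (fun i => x 0 i * (j == i)%:R +
    ((if j == v then c else 0) * x 0 i) * (w == i)%:R)) => [|i _].
  rewrite big_split /= !sum_mul_delta; congr (_ + _).
  by case: eqP; rewrite ?mul0r.
by rewrite !mxE [j == i]eq_sym; ring.
Qed.

(** Equal columns v and w give both coordinates the same sign under every deck transformation, so
    the shear respects the linear part and only adds a multiple of k_w to k_v. The row v thereby
    added to the twist is cancelled by the slide. *)
Lemma preserves_orbits_shear A v w (a : 'F_2) : v != w -> equal_columns A v w ->
  preserves_orbits A (mx_slide v w A) (shear_coord v w (sg a)).
Proof.
move=> vw eqc x _ [k ->].
pose u : 'rV[int]_n := \row_j (if j == v then sg a * k 0 w else 0).
have uE i : parity u 0 i = parity k 0 w * (v == i)%:R.
  rewrite !mxE [v == i]eq_sym; have [_|_] := eqVneq i v; last by rewrite mulr0.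
  by rewrite intrM intr_sg sg_F2 mul1r mulr1.
have twE : twist (mx_slide v w A) (k + u) = twist A k.
  apply/rowP => j; rewrite mxE (eq_bigr (fun i => parity k 0 i * A i j +
    ((parity k 0 i * A v j) * (w == i)%:R +
    (parity k 0 w * (A i j + (w == i)%:R * A v j)) * (v == i)%:R))); last first.
    move=> i _; rewrite parityD uE -[mx_slide _ _ _]/(\matrix_(_, _) _).
    by rewrite [fun_of_matrix (\matrix_(_, _) _) _ _]mxE [w == i]eq_sym; ring.
  rewrite big_split big_split /= !sum_mul_delta [w == v]eq_sym (negPf vw) mul0r addr0.
  by rewrite F2_addrr addr0 mxE.
have tvw : twist A k 0 v = twist A k 0 w.
  by rewrite !mxE; apply: eq_bigr => i _; rewrite eqc.
exists (k + u); apply/rowP => j; rewrite deckE twE [LHS]mxE [shear_coord _ _ _ _ _ _]mxE.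
rewrite !deckE [fun_of_matrix (k + u) _ _]mxE intrD [u 0 j]mxE.
have [->|_] := eqVneq j v; last by rewrite !addr0.
by rewrite tvw intrM intr_sg; ring.
Qed.

Lemma affine_equivalent_slide A v w : v != w -> equal_columns A v w ->
  affine_equivalent A (mx_slide v w A).
Proof.
move=> vw eqc; have wv : (w == v) = false by rewrite eq_sym (negPf vw).
exists (shear_coord v w (sg 0)), (shear_coord v w (sg 1)); split.
- move=> x; apply/rowP => j; rewrite !mxE wv; case: eqP => _; rewrite ?sg0 ?sg1; ring.
- move=> x; apply/rowP => j; rewrite !mxE wv; case: eqP => _; rewrite ?sg0 ?sg1; ring.
- by split; exact: affine_shear.
- exact: preserves_orbits_shear.
- rewrite -{2}(mx_slideK A vw); apply: preserves_orbits_shear => //.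
  exact: equal_columns_slide.
Qed.
End Affine.

Lemma mx_reachable_affine R n (A A' : 'M['F_2]_n) r : ranked r A ->
  mx_reachable A A' -> affine_equivalent R A A' /\ ranked r A'.
Proof.
move=> rA; elim=> [|{}A' v _ [AA' rA']|{}A' v w vw eqc _ [AA' rA']].
- by split=> //; exact: affine_equivalent_refl.
- split; last exact: ranked_local_complement.
  exact: affine_equivalent_trans AA' (affine_equivalent_local_complement _ v rA').
- split; last exact: ranked_slide.
  exact: affine_equivalent_trans AA' (affine_equivalent_slide _ vw eqc).
Qed.

(** * Smoothness in the standard charts *)

Section LocallyAffine.
Variables (R : realType) (n m : nat).

Definition locally_affine (U : set 'rV[R]_n) (f : 'rV[R]_n -> 'rV[R]_m) :=
  forall x, U x -> exists (L : 'M[R]_(n, m)) b, \forall y \near x, f y = y *m L + b.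

Lemma affine_continuous (L : 'M[R]_(n, m)) b : continuous (fun y : 'rV[R]_n => y *m L + b).
Proof.
move=> x U /rV_nearP[d d0 dU].
pose M := 1 + \sum_i \sum_j `|L i j|.
have M0 : 0 < M by rewrite ltr_wpDr// sumr_ge0// => i _; rewrite sumr_ge0.
apply/rV_nearP; exists (d / M) => [|y xy]; first by rewrite divr_gt0.
apply: dU => j; rewrite !mxE opprD addrACA subrr addr0 -sumrB.
apply: le_lt_trans (ler_norm_sum _ _ _) _.
apply: (@le_lt_trans _ _ (\sum_i (d / M) * `|L i j|)).
  by apply: ler_sum => i _; rewrite -mulrBl normrM ler_wpM2r// ltW.
rewrite -mulr_sumr mulrAC ltr_pdivrMr// ltr_pM2l//.
rewrite /M addrC; apply: (@le_lt_trans _ _ (\sum_i \sum_j `|L i j|)); last by rewrite ltrDl.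
by apply: ler_sum => i _; rewrite (bigD1 j)//= lerDl sumr_ge0.
Qed.

Lemma cvg_affine_quotient (f : 'rV[R]_n -> 'rV[R]_m) (x v : 'rV[R]_n) (L : 'M[R]_(n, m)) b :
  (\forall y \near x, f y = y *m L + b) ->
  (h^-1 *: ((f \o shift x) (h *: v) - f x))%R @[h --> (0 : R)^'] --> v *m L.
Proof.
move=> fE; apply: cvg_near_cst.
have [d d0 dP] := (rV_nearP _ _).1 fE.
pose M := 1 + \sum_j `|v 0 j|.
have M0 : 0 < M by rewrite ltr_wpDr// sumr_ge0.
near=> h; rewrite /= dP => [|j]; last first.
  rewrite !mxE opprD addrCA subrr addr0 normrN normrM.
  apply: (@le_lt_trans _ _ (`|h| * M)); last first.
    rewrite -ltr_pdivlMr//; near: h; apply: dnbhs0_lt; exact: divr_gt0.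
  by rewrite ler_wpM2l// /M (bigD1 j)//= addrCA lerDl addr_ge0// sumr_ge0.
rewrite (nbhs_singleton fE).
have h0 : h != 0 by near: h; exact: nbhs_dnbhs_neq.
rewrite mulmxDl opprD addrACA subrr addr0 addrK -scalemxAl scalerA mulVf// scale1r.
by [].
Unshelve. all: by end_near. Qed.

Lemma locally_affine_continuous (U : set 'rV[R]_n) (f : 'rV[R]_n -> 'rV[R]_m) :
  locally_affine U f -> forall x, U x -> {for x, continuous f}.
Proof.
move=> fU x /fU[L [b fE]] V; rewrite (nbhs_singleton fE) => /affine_continuous xV.
have {} xV : \forall y \near x, V (y *m L + b) by [].
suff : \forall y \near x, V (f y) by [].
by near=> y; rewrite (near fE y)//; near: y.
Unshelve. all: by end_near. Qed.

(** Directional derivatives of a locally affine map are locally constant, hence again locally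
    affine. *)
Lemma Ck_on_locally_affine k (U : set 'rV[R]_n) (f : 'rV[R]_n -> 'rV[R]_m) :
  locally_affine U f -> Ck_on k U f.
Proof.
elim: k f => [|k IH] f fU; split=> //; try exact: locally_affine_continuous fU.
move=> i; split=> [x /fU[L [b fE]]|].
  apply/cvg_ex; exists (delta_mx 0 i *m L); exact: cvg_affine_quotient fE.
apply: IH => x /fU[L [b fE]]; exists 0, (delta_mx 0 i *m L).
near=> y; rewrite mulmx0 add0r.
apply/cvg_lim => //; apply: (cvg_affine_quotient (b := b)).
near: y; exact: (near_join fE).
Unshelve. all: by end_near. Qed.

End LocallyAffine.

(** * The standard charts seen in the universal cover *)

Section Charts.
Variables (R : realType) (n : nat) (A : 'M['F_2]_n) (r : 'I_n -> nat).
Hypothesis rA : ranked r A.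
Implicit Types (v : {ffun 'I_n -> bool}) (x y z : 'rV[R]_n).

Let Adiag j : A j j = 0. Proof. exact: ranked_diag rA. Qed.

Lemma char_fun_vertex v l i :
  char_fun A (vertex_facet v l) i 0 = (i == l)%:R + (v l)%:R * A l i.
Proof.
rewrite /vertex_facet; case: (v l); first by rewrite char_fun_rshift mul1r.
by rewrite char_fun_lshift mul0r addr0.
Qed.

Local Notation vertex_basis v := [tuple char_fun A (vertex_facet v l) | l < n].

Lemma vertex_basis_sum v (c : 'I_n -> 'F_2) i :
  (\sum_(l < n) c l *: (vertex_basis v)`_l) i 0 =
  c i + \sum_l c l * (v l)%:R * A l i.
Proof.
rewrite summxE (eq_bigr (fun l => c l * (i == l)%:R + c l * (v l)%:R * A l i)).
  by rewrite big_split /= sum_mul_delta.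
move=> l _; rewrite mxE -tnth_nth tnth_mktuple char_fun_vertex; ring.
Qed.

(** The coefficient matrix 1 + diag(v) A is unitriangular in the order of ranks. *)
Lemma vertex_basis_free v : free (vertex_basis v).
Proof.
apply/freeP => c cE i; have [N] := ubnP (r i); elim: N i => // N IH i iN.
have /colP/(_ i) := cE; rewrite vertex_basis_sum mxE big1 ?addr0// => l _.
have [->|Ali] := eqVneq (A l i) 0; first by rewrite mulr0.
by rewrite IH ?mul0r//; exact: leq_trans (rA.1 _ _ Ali) iN.
Qed.

Lemma vertex_basis_coord v (g : 'cV['F_2]_n) :
  exists c : 'I_n -> 'F_2, forall i, g i 0 = c i + \sum_l c l * (v l)%:R * A l i.
Proof.
have gX : g \in <<vertex_basis v>>%VS.
  suff -> : <<vertex_basis v>>%VS = fullv by exact: memvf.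
  apply/eqP; rewrite eqEdim subvf (eqP (vertex_basis_free v)) size_tuple.
  by rewrite dimvf dim_matrix mulr1 /=.
exists (fun l => coord (vertex_basis v) l g) => i.
by rewrite {1}(coord_span gX) vertex_basis_sum.
Qed.

Definition vertex_box v : set 'rV[R]_n := [set x | forall l, `|x 0 l - (v l)%:R| < 1].

(** This is the chart at [v] read in the cover, on the box of radius 1 about [v]: the coordinate x_l
    if v_l = 0, and 1 - x_l if v_l = 1. The [id l] fits [affine_coord]. *)
Definition flip v x : 'rV[R]_n := \row_l ((v l)%:R + (-1) ^+ v l * x 0 (id l)).

Lemma flipK v : involutive (flip v).
Proof. by move=> x; apply/rowP => l; rewrite !mxE /=; case: (v l) => /=; ring. Qed.

Lemma affine_flip v : affine (flip v).
Proof. exact: affine_coord. Qed.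

Lemma flip_box v x : vertex_box v x <-> forall l, `|flip v x 0 l| < 1.
Proof.
by split=> xv l; have := xv l; rewrite mxE /=; case: (v l) => /=;
  rewrite ?expr1 ?expr0 ?mulN1r ?mul1r ?add0r ?subr0 1?distrC.
Qed.

Lemma box_coordinate (p x : R) (z : int) (s : 'F_2) (b : bool) :
  0 <= p <= 1 -> x = 2 * z%:~R + sg s * p -> `|x - b%:R| < 1 ->
  [/\ z%:~R = s * b%:R, sg s * `|p - b%:R| = b%:R + (-1) ^+ b * x,
      p = 0 -> ~~ b & p = 1 -> b].
Proof.
move=> /andP[p0 p1] xE; rewrite ltr_norml => /andP[].
case: b => /= x1 x2.
  have [[s0 z0]|[s1 z1]] : (s = 0 /\ z = 0) \/ (s = 1 /\ z = 1).
    move: xE; case: (F2_cases s) => ->; rewrite ?sg0 ?sg1 => xE; [left|right]; split=> //.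
      by apply: (@int_lt1 R); lra.
    by apply/eqP; rewrite -subr_eq0; apply/eqP/(@int_lt1 R); rewrite intrB; lra.
  - move: xE; rewrite s0 z0 sg0 mulr0z mulr0 add0r !mul1r => xE; split=> //.
    + by rewrite mul0r.
    + by rewrite ler0_norm ?expr1; lra.
    + by move=> pE; exfalso; lra.
  - move: xE; rewrite s1 z1 sg1 mulr1z => xE; split=> //; rewrite ?expr1.
    + by rewrite mulr1.
    + by rewrite ler0_norm; lra.
    + by move=> pE; exfalso; lra.
have z0 : z = 0.
  by move: xE; case: (F2_cases s) => ->; rewrite ?sg0 ?sg1 => xE; apply: (@int_lt1 R); lra.
move: xE; rewrite z0 mulr0z mulr0 add0r => xE; split=> //.
- by rewrite mulr0.
- by rewrite subr0 ger0_norm// add0r mul1r.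
- by move=> pE; move: xE x1 x2; rewrite pE; case: (F2_cases s) => ->; rewrite ?sg0 ?sg1; lra.
Qed.

Lemma vertex_nbhdP v (p : cube R n) : vertex_nbhd v p <->
  forall l, (set_val p 0 l = 0 -> ~~ v l) /\ (set_val p 0 l = 1 -> v l).
Proof.
split=> [pv l|pv F].
  split=> [/eqP pl|/eqP pl].
    have [|l'] := pv (lshift n l); first by rewrite on_facet_lshift.
    rewrite /vertex_facet; case: ifPn => [_ /eqP|vl /lshift_inj->//].
    by rewrite eq_lrshift.
  have [|l'] := pv (rshift n l); first by rewrite on_facet_rshift.
  rewrite /vertex_facet; case: ifPn => [vl /rshift_inj->//|_ /eqP].
  by rewrite eq_rlshift.
case: (split_ordP F) => l ->.
  by rewrite on_facet_lshift => /eqP/(pv l).1 /negPf vl; exists l; rewrite /vertex_facet vl.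
by rewrite on_facet_rshift => /eqP/(pv l).2 vl; exists l; rewrite /vertex_facet vl.
Qed.

(** Inside the box k_l has the parity of s_l v_l. This turns g = s + kA into sum_l s_l
    lambda(F_(l)), so the chart coordinates of [g] are the signs [s]. *)
Lemma orbit_box v x (a : precover R n) : vertex_box v x -> same_orbit A (sheet a) x ->
  vertex_nbhd v a.1 /\
  forall l, (-1) ^+ coord (vertex_basis v) l (a.2 : 'cV_n) * `|set_val a.1 0 l - (v l)%:R|
    = flip v x 0 l.
Proof.
move=> xv [k kE]; pose s l := twist A k 0 l + a.2 l 0.
have xE l : x 0 l = 2 * (k 0 l)%:~R + sg (s l) * set_val a.1 0 l.
  by rewrite kE deckE [sheet _ _ _]mxE mulrA -sgD.
have box l := box_coordinate (set_val_cube a.1 l) (xE l) (xv l).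
have gE : a.2 = \sum_(l < n) s l *: (vertex_basis v)`_l.
  apply/colP => i; rewrite vertex_basis_sum.
  rewrite (eq_bigr (fun l => parity k 0 l * A l i)) => [|l _]; last first.
    by have [<- _ _ _] := box l; rewrite mxE.
  have -> : \sum_l parity k 0 l * A l i = twist A k 0 i by rewrite mxE.
  by rewrite /s addrAC F2_addrr add0r.
split=> [|l]; first by apply/vertex_nbhdP => l; have [] := box l.
rewrite [X in coord _ _ X]gE coord_sum_free ?vertex_basis_free//.
by rewrite [RHS]mxE; have [_ <-] := box l.
Qed.

Lemma chart_cover_map v x : vertex_box v x -> chart A v (cover_map A x) = flip v x.
Proof.
move=> xv; have : same_orbit A (sheet (cover_repr (cover_map A x))) x.
  have := cover_class_reprK (cover_map A x).
  rewrite -(cover_map_sheet Adiag (same_orbit_refl A (sheet (cover_repr (cover_map A x))))).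
  by move/(cover_map_eq Adiag).
rewrite /chart; case: (cover_repr _) => p g /(orbit_box xv)[_ h].
by apply/rowP => l; rewrite mxE; exact: h.
Qed.

Lemma chart_domP v X : chart_dom A v X <-> exists2 x, vertex_box v x & cover_map A x = X.
Proof.
split=> [[a /vertex_nbhdP av <-]|[x xv <-]]; last first.
  by exists (fold_cube x, fold_label A x) => //=; have [] := orbit_box xv (same_orbit_sheet A x).
have [c cE] := vertex_basis_coord v (a.2 : 'cV_n).
(* Where v_l = 1 and the final sign is negative, a translation by 2 brings the coordinate from (-1,
   0) back to the neighbourhood (0, 2) of 1, up to endpoints. *)
pose k : 'rV[int]_n := \row_l (if v l then (c l : nat)%:Z else 0).
have kE l : parity k 0 l = c l * (v l)%:R.
  rewrite !mxE; case: (v l); last by rewrite mulr0.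
  by rewrite mulr1; case: (F2_cases (c l)) => ->; apply/val_inj.
have tE i : twist A k 0 i = \sum_l c l * (v l)%:R * A l i.
  by rewrite mxE; apply: eq_bigr => l _; rewrite kE.
exists (deck A k (sheet a)); last by apply: cover_map_sheet => //; exists k.
move=> l; rewrite deckE [sheet _ _ _]mxE mulrA -sgD.
have -> : twist A k 0 l + (a.2 : 'cV_n) l 0 = c l by rewrite cE -tE addrCA F2_addrr addr0.
rewrite [k 0 l]mxE.
have /andP[p0 p1] := set_val_cube a.1 l; have [pv0 pv1] := av l.
move: pv0 pv1; move: (set_val a.1 0 l) p0 p1 => p p0 p1.
case: (v l) => /= pv0 pv1; rewrite ltr_norml.
  have {}p0 : 0 < p by rewrite lt_neqAle p0 andbT; apply/eqP => /esym/pv0.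
  case: (F2_cases (c l)) => ->; rewrite ?sg0 ?sg1.
    by rewrite [(nat_of_ord 0)%:~R](_ : _ = 0)//; lra.
  by rewrite [(nat_of_ord 1)%:~R](_ : _ = 1)//; lra.
have {}p1 : p < 1 by rewrite lt_neqAle p1 andbT; apply/eqP => /pv1.
by case: (F2_cases (c l)) => ->; rewrite ?sg0 ?sg1 mulr0z; lra.
Qed.

Lemma chart_inv_cover_map v z : (forall l, `|z 0 l| < 1) ->
  chart_inv A v z = cover_map A (flip v z).
Proof.
move=> z1; have zv : vertex_box v (flip v z) by apply/flip_box; rewrite flipK.
rewrite -{1}[z](flipK v) -(chart_cover_map zv) /chart_inv pinvKV//.
  move=> X Y /set_mem/chart_domP[x xv <-] /set_mem/chart_domP[y yv <-].
  by rewrite !chart_cover_map// => /(can_inj (flipK v))->.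
by apply/mem_set/chart_domP; exists (flip v z).
Qed.

End Charts.

(** * Diffeomorphisms from affine equivalences *)

Lemma near_unit_box (R : realType) n (x : 'rV[R]_n) : (forall i, `|x 0 i| < 1) ->
  \forall y \near x, forall i, `|(y : 'rV_n) 0 i| < 1.
Proof.
move=> x1; apply/rV_nearP; exists (\big[Num.min/1]_i (1 - `|x 0 i|)).
  by apply/bigmin_gtP; split=> // i _; rewrite subr_gt0.
move=> y xy i; have := xy i.
have : \big[Num.min/1]_i (1 - `|x 0 i|) <= 1 - `|x 0 i| by exact: bigmin_le.
have := ler_normB (x 0 i) (x 0 i - y 0 i); rewrite opprB addrC subrK.
by lra.
Qed.

Lemma affine_smooth_map (R : realType) n m (A : 'M['F_2]_n) (B : 'M['F_2]_m) rA rB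
    (F : 'rV[R]_n -> 'rV[R]_m) (f : small_cover R n A -> small_cover R m B) :
  ranked rA A -> ranked rB B -> affine F ->
  (forall x, f (cover_map A x) = cover_map B (F x)) -> smooth_map f.
Proof.
move=> rkA rkB aF fE.
have Ad j : A j j = 0 by exact: ranked_diag rkA.
have Bd j : B j j = 0 by exact: ranked_diag rkB.
have Fc : continuous F.
  by case: aF => L [b FE]; rewrite (_ : F = fun x => x *m L + b);
    [exact: affine_continuous | exact/funext].
split.
  apply/continuousP => U oU.
  have -> : f @^-1` U = cover_map A @` (F @^-1` (cover_map B @^-1` U)).
    apply/seteqP; split=> [X fX|_ [x Ux <-]] /=; last by rewrite fE.
    have [x xX] := cover_map_surj Ad X; exists x => //=.
    by rewrite -fE xX.
  apply: (cover_map_open Ad); apply: open_comp => [x _|]; first exact: Fc.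
  by apply: open_comp => // x _; exact: cover_map_continuous.
move=> v w k; apply: Ck_on_locally_affine.
move=> z0 [X [/(chart_domP rkA)[x0 x0v <-] /=]]; rewrite fE => /(chart_domP rkB)[y0 y0w yE] <-.
rewrite (chart_cover_map rkA x0v).
have /(cover_map_eq Bd)[l lE] : cover_map B (F x0) = cover_map B y0 by [].
(* The deck transformation [l] moves [F x0] into the box at [w]; [T] is then the expression of [f]
   in the two charts near the given point. *)
pose T z := flip w (deck B l (F (flip v z))).
have aT : affine T := affine_comp (affine_comp (affine_comp (@affine_flip R n v) aF)
  (affine_deck R B l)) (@affine_flip R m w).
have [L [b TE]] := aT; exists L, b.
have Tc : continuous T.
  by rewrite (_ : T = fun x => x *m L + b); [exact: affine_continuous | exact/funext].
near=> z.
have z1 : forall i, `|z 0 i| < 1.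
  by near: z; apply: near_unit_box; apply/flip_box.
rewrite /= (chart_inv_cover_map rkA)// fE.
have -> : cover_map B (F (flip v z)) = cover_map B (deck B l (F (flip v z))).
  by apply/cover_map_eq => //; exists l.
rewrite -TE (chart_cover_map rkB)//; apply/flip_box; rewrite -/(T z); near: z.
suff h : \forall y \near T (flip v x0), forall i, `|(y : 'rV_m) 0 i| < 1 by exact: Tc h.
by apply: near_unit_box; rewrite /T flipK -lE; apply/flip_box.
Unshelve. all: by end_near. Qed.

Lemma affine_equivalent_diffeomorphic (R : realType) n m (A : 'M['F_2]_n)
    (B : 'M['F_2]_m) rA rB : ranked rA A -> ranked rB B ->
  affine_equivalent R A B -> diffeomorphic R n m A B.
Proof.
move=> rkA rkB [F [G [FG GF [aF aG] oF oG]]].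
have Ad j : A j j = 0 by exact: ranked_diag rkA.
have Bd j : B j j = 0 by exact: ranked_diag rkB.
pose sA X : 'rV[R]_n := sval (cid (cover_map_surj Ad X)).
pose sB X : 'rV[R]_m := sval (cid (cover_map_surj Bd X)).
have sAK X : cover_map A (sA X) = X by exact: svalP (cid (cover_map_surj Ad X)).
have sBK X : cover_map B (sB X) = X by exact: svalP (cid (cover_map_surj Bd X)).
pose f X := cover_map B (F (sA X)); pose g X := cover_map A (G (sB X)).
have fE x : f (cover_map A x) = cover_map B (F x).
  by apply/(cover_map_eq Bd)/oF/(cover_map_eq Ad); rewrite sAK.
have gE x : g (cover_map B x) = cover_map A (G x).
  by apply/(cover_map_eq Ad)/oG/(cover_map_eq Bd); rewrite sBK.
exists f, g; split.
- by move=> X; rewrite -[X in g (f X)]sAK fE gE FG sAK.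
- by move=> X; rewrite -[X in f (g X)]sBK gE fE GF sBK.
- exact: affine_smooth_map rkA rkB aF fE.
- exact: affine_smooth_map rkB rkA aG gE.
Qed.

Theorem theorem4p4 (R : realType) (V W : finType)
    (D : digraph V) (H : digraph W) (n m : nat)
    (s : 'I_n -> V) (t : 'I_m -> W) :
  acyclic D -> acyclic H -> bijective s -> bijective t ->
  bott_equivalent H D <->
  diffeomorphic R n m (adjacency_matrix s D) (adjacency_matrix t H).
Proof.
move=> aD aH bs bt; have [s' sK s'K] := bs; have [t' tK t'K] := bt.
have [rD rkD] := acyclic_ranked s'K aD; have [rH rkH] := acyclic_ranked t'K aH.
split=> [/(bott_equivalentE H aD bs bt)[A DA [h bh hA]]|[f [g [fg gf [fc _] [gc _]]]]].
  have [DA' _] := mx_reachable_affine R rkD DA.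
  apply: (affine_equivalent_diffeomorphic rkD rkH).
  exact: affine_equivalent_trans DA' (affine_equivalent_relabel R bh hA).
apply/(bott_equivalentE H aD bs bt).
exact: homeomorphic_reachable rkD rkH fc gc fg gf.
Qed.
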